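(* Suppose Assumptions 1 and 2 of the context hold. Let $\varepsilon_{\mathrm{feat}}=\tfrac12\int\min(\rho_+,\rho_-)\,d\mu$, let $\tau_{\mathrm{feat}}:=1-2\varepsilon_{\mathrm{feat}}$ (the total-variation distance between $\mathbb{P}_+$ and $\mathbb{P}_-$), and set $$\tau_1:=\big(1-e^{-\Delta}\big)\,\gamma\,\tau_{\mathrm{feat}}.$$ Assume that ties are null: $\mathbb{P}(T_0=0)=\mathbb{P}(T_1=0)=0$. Then $\mathcal{E}(1)\le\mathcal{E}(0)$, and for every $\delta\in(0,\tau_1/2)$, $$\mathcal{E}(0)-\mathcal{E}(1)\;\ge\;\Big(\frac{\tau_1}{2}-\delta\Big)\;\mathbb{P}\Big(\big|\log\psi(X_o)\big|\le\log\tfrac{1+\delta}{1-\delta}\Big),$$ where the probability is over the balanced feature mixture (i.e. $X_o\sim\frac12\mathbb{P}_++\frac12\mathbb{P}_-$). In particular, $\mathcal{E}(1)<\mathcal{E}(0)$ whenever $\log\psi(X)$ puts positive mass in every neighbourhood of $0$ under the balanced mixture; this is the case for the Gaussian mixture $\mathbb{P}_\pm=\mathcal{N}(\pm\boldsymbol{\mu},\sigma^2I_d)$ with $\boldsymbol{\mu}\ne\mathbf{0}$, $\sigma>0$.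
   Context: Parameters. Constants $a>b>0$; $\Delta=\frac{a+b}{2}$, assumed $>1$; $\gamma=\frac{a-b}{a+b}\in(0,1)$. Limit object $(T,o,y,X)$. $T$ is a Poisson Galton--Watson tree rooted at $o$: every vertex independently has $\mathrm{Poi}(\Delta)$ children. Labels $y_v\in\{\pm1\}$ follow a broadcast process: $y_o$ is uniform on $\{\pm1\}$ and, independently along edges and of the tree shape, each child has its parent's label with probability $\frac{1+\gamma}{2}$ and the opposite label with probability $\frac{1-\gamma}{2}$. Given the tree and labels, the features $X_v\in\mathbb{R}^d$ are independent with $X_v\sim\mathbb{P}_{y_v}$, where $\mathbb{P}_+,\mathbb{P}_-$ are two given probability laws on $\mathbb{R}^d$. $N_k$ is the set of vertices at graph distance exactly $k$ from $o$. All probabilities are on this object. Features and classifier. $\rho_\pm$ are the densities of $\mathbb{P}_\pm$ with respect to a common base measure $\mu$; $\psi=\rho_+/\rho_-$; $t(x)=\frac{\rho_+(x)-\rho_-(x)}{\rho_+(x)+\rho_-(x)}\in[-1,1]$, so $\log\psi=2\operatorname{artanh}(t)$. For $k\ge0$, $M_k(x)=2\operatorname{artanh}(\gamma^k t(x))$. For $\ell\ge 0$, $$T_\ell=\sum_{k=0}^{\ell}\sum_{v\in N_k}M_k(X_v),\qquad \mathcal{E}(\ell)=\mathbb{P}(y_oT_\ell\le 0).$$ Assumption 1. $\mathbb{P}_+$ and $\mathbb{P}_-$ are mutually absolutely continuous, with densities $\rho_\pm$ with respect to $\mu$, and there is a $\mu$-measure-preserving involution $\tau:\mathbb{R}^d\to\mathbb{R}^d$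 with $\rho_-(x)=\rho_+(\tau(x))$ for $\mu$-a.e. $x$. Assumption 2. $\vartheta:=\mathbb{E}_{X\sim\mathbb{P}_+}[t(X)^2]>0$. *)

(* Defs.v *)
From HB Require Import structures.
From mathcomp Require Import all_boot all_order all_algebra.
From mathcomp Require Import all_classical all_reals all_analysis.
Set Implicit Arguments.
Unset Strict Implicit.
Unset Printing Implicit Defensive.
Import Order.TTheory GRing.Theory Num.Theory.
Import numFieldNormedType.Exports.
Local Open Scope classical_set_scope.
Local Open Scope ring_scope.

(* R^n is n.-tuple R, whose sigma-algebra in the library is the one generated
   by the coordinates, i.e. the Borel one. *)

Section features.
Context {R : realType} {n : nat}.
Local Notation Rn := (n.-tuple R).
Implicit Types (mu : {measure set Rn -> \bar R}) (rho rhop rhom : Rn -> R).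
Implicit Types (P Pp Pm : probability Rn R).

Definition is_density mu rho P : Prop :=
  [/\ measurable_fun setT rho, (forall x, 0 <= rho x) &
      forall A, measurable A -> P A = (\int[mu]_(x in A) (rho x)%:E)%E].

Definition preserving_involution mu (tau : Rn -> Rn) : Prop :=
  [/\ measurable_fun setT tau, involutive tau &
      forall A, measurable A -> pushforward mu tau A = mu A].

Definition assumption1 mu rhop rhom Pp Pm : Prop :=
  [/\ Pp `<< Pm, Pm `<< Pp, is_density mu rhop Pp, is_density mu rhom Pm &
      exists2 tau, preserving_involution mu tau &
        {ae mu, forall x, rhom x = rhop (tau x)}].

(* Quotients by 0 are 0 in the library; under assumption1 the sets where the
   denominators below vanish are null for both laws. *)
Definition psi rhop rhom (x : Rn) : R := rhop x / rhom x.

Definition tstat rhop rhom (x : Rn) : R :=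
  (rhop x - rhom x) / (rhop x + rhom x).

Definition assumption2 rhop rhom Pp : Prop :=
  (0 < 'E_Pp[fun x => (tstat rhop rhom x ^+ 2)%R])%E.

Definition artanh (u : R) : R := ln ((1 + u) / (1 - u)) / 2.

Definition Mstat (gam : R) rhop rhom (k : nat) (x : Rn) : R :=
  2 * artanh (gam ^+ k * tstat rhop rhom x).

Definition eps_feat mu rhop rhom : R :=
  2^-1 * \int[mu]_x Num.min (rhop x) (rhom x).

Definition tau_feat mu rhop rhom : R := 1 - 2 * eps_feat mu rhop rhom.

Definition balanced Pp Pm (A : set Rn) : \bar R :=
  ((2^-1)%:E * (Pp A + Pm A))%E.

Definition positive_mass_near0 rhop rhom Pp Pm : Prop :=
  forall U : set R, open U -> U 0 ->
    (0 < balanced Pp Pm [set x | U (ln (psi rhop rhom x))])%E.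

(* N(m, s^2 I_n): independent coordinates, the i-th one being N(m_i, s^2). *)
Definition isotropic_gaussian (m : Rn) (s : R) P : Prop :=
  forall A : 'I_n -> set R, (forall i, measurable (A i)) ->
    P [set x | forall i, A i (tnth x i)] =
      (\prod_(i < n) normal_prob (tnth m i) s (A i))%E.

End features.

Section parameters.
Context {R : realType}.
Implicit Types a b : R.

Definition Delta a b : R := (a + b) / 2.
Definition gamma a b : R := (a - b) / (a + b).

Definition tau1 a b (tfeat : R) : R :=
  (1 - expR (- Delta a b)) * gamma a b * tfeat.

End parameters.

(* Vertices are Ulam-Harris words read towards the root: [::] is the root o
   and i :: u is the i-th potential child of u.  Child counts, labels and
   features are attached to every word; only the words in the tree selected by
   the child counts c are used. *)
Fixpoint in_tree (c : seq nat -> nat) (v : seq nat) : bool :=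
  if v is i :: u then in_tree c u && (i < c u)%N else true.

(* The graph distance from v to the root is the length of v. *)
Definition generation (c : seq nat -> nat) (k : nat) : set (seq nat) :=
  [set v | in_tree c v /\ size v = k].

Lemma finite_generation (c : seq nat -> nat) (k : nat) :
  finite_set (generation c k).
Proof.
elim: k => [|k IHk].
  by apply: (sub_finite_set _ (finite_set1 [::])) => v [_ /size0nil].
apply: (@sub_finite_set _ _
  (\bigcup_(u in generation c k) ((cons^~ u) @` `I_(c u)))).
  move=> [[_ //]|i u] [/=] /andP[tu ui] [su].
  by exists u; [split|exists i].
by apply: bigcup_finite => // u _; exact: finite_image.
Qed.

Section limit_object.
Context {R : realType} {n : nat} {d : measure_display} {Omega : measurableType d}.
Context {P : probability Omega R}.
Variables (a b : R) (Pp Pm : probability (n.-tuple R) R).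
Variables (K : seq nat -> {RV P >-> nat}) (y : seq nat -> {RV P >-> bool})
          (X : seq nat -> {RV P >-> n.-tuple R}).

Definition sigma_of d' (T : measurableType d') (Z : Omega -> T) :
    set (set Omega) :=
  preimage_set_system setT Z measurable.

Definition mutually_independent (I : choiceType)
    (G : I -> set (set Omega)) : Prop :=
  forall (s : seq I) (A : I -> set Omega), uniq s ->
    (forall i, i \in s -> G i (A i)) ->
    P (\bigcap_(i in [set` s]) A i) = (\prod_(i <- s) P (A i))%E.

(* The label true is +1 and the label false is -1. *)
Definition sign (s : bool) : R := if s then 1 else -1.

Definition law_of (s : bool) : probability (n.-tuple R) R :=
  if s then Pp else Pm.

(* Source of randomness of the broadcast at v: the label itself at the root,
   and otherwise whether v agrees with its parent. *)
Definition broadcast_bit (v : seq nat) (w : Omega) : bool :=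
  if v is _ :: u then y v w == y u w else y [::] w.

Definition poisson_galton_watson : Prop :=
  forall v k, P [set w | K v w = k] = (poisson_pmf (Delta a b) k)%:E.

Definition broadcast_labels : Prop :=
  P [set w | y [::] w = true] = (2^-1)%:E /\
  forall i u, P [set w | y (i :: u) w = y u w] = ((1 + gamma a b) / 2)%:E.

Definition tree_label_independent : Prop :=
  mutually_independent (fun j : seq nat + seq nat =>
    match j with
    | inl v => sigma_of (K v)
    | inr v => sigma_of (broadcast_bit v)
    end).

Definition tree_label_sigma : set (set Omega) :=
  <<s \bigcup_v (sigma_of (K v) `|` sigma_of (y v)) >>.

Definition conditional_features : Prop :=
  forall (E : set Omega) (s : seq (seq nat)) (A : seq nat -> set (n.-tuple R)),
    tree_label_sigma E -> uniq s -> (forall v, measurable (A v)) ->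
    P (E `&` \bigcap_(v in [set` s]) (X v @^-1` A v)) =
      (\int[P]_(w in E) \prod_(v <- s) law_of (y v w) (A v))%E.

Definition limit_object : Prop :=
  [/\ poisson_galton_watson, broadcast_labels, tree_label_independent &
      conditional_features].

Definition score (rhop rhom : n.-tuple R -> R) (l : nat) (w : Omega) : R :=
  \sum_(0 <= k < l.+1)
    \sum_(v \in generation (fun u => K u w) k)
       Mstat (gamma a b) rhop rhom k (X v w).

Definition error (rhop rhom : n.-tuple R -> R) (l : nat) : R :=
  fine (P [set w | sign (y [::] w) * score rhop rhom l w <= 0]).

End limit_object.

Arguments mutually_independent {R d Omega} P {I} G.

(* Main.v *)
Require Import Defs.
From HB Require Import structures.
From mathcomp Require Import all_boot all_order all_algebra.
From mathcomp Require Import all_classical all_reals all_analysis.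
From mathcomp Require Import measurable_realfun ring lra.
Import Order.TTheory GRing.Theory Num.Theory.
Import numFieldNormedType.Exports.
Local Open Scope classical_set_scope.
Local Open Scope ring_scope.
Set Implicit Arguments.
Unset Strict Implicit.
Unset Printing Implicit Defensive.

(* Given the root label, the number k of children of the root and the features at
   depth at most 1 are independent, the root feature having law P_y and a child
   feature the mixture (1+gamma)/2 P_y + (1-gamma)/2 P_(-y).  Since the ratio of the
   two mixtures at depth j is (1 + gamma^j t)/(1 - gamma^j t) = exp M_j, the score T_1
   is the log-likelihood ratio of all these data, so no decision based on them errs
   less than the sign of T_1 (on {K_o = k}, the law given y_o = + has density exp T_1
   with respect to the law given y_o = -).  Comparing with the sign of T_0 gives
   E(1) <= E(0).  Comparing with the decision that follows the sign of t at the first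
   child when |log psi(X_o)| <= log((1+delta)/(1-delta)) and the root has a child, and
   the sign of T_0 otherwise, gives the quantitative bound: on that event, the root
   errs with probability at least (1 - delta)/2 and the first child with probability
   (1 - gamma tau_feat)/2.  In the Gaussian case P_+ has density exp(2 <m, x>/s^2)
   with respect to P_-, which is close to 1 on a small box around 0, a set of positive
   mass. *)

(** * Change of variables and product laws *)

Lemma integral_mul_indic d (T : measurableType d) (R : realType)
    (m : {measure set T -> \bar R}) (D A : set T) (f : T -> R) :
  (\int[m]_(x in D `&` A) (f x)%:E = \int[m]_(x in D) (f x * \1_A x)%:E)%E.
Proof.
rewrite integral_mkcondr; apply: eq_integral => x _.
by rewrite patchE indicE; case: ifP; rewrite ?mulr1 ?mulr0.
Qed.

Section change_of_variables.
Context d1 d2 (X : measurableType d1) (Y : measurableType d2) (R : realType).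
Variables (m : {measure set X -> \bar R}) (Q : {measure set Y -> \bar R}).
Variables (phi : X -> Y) (D : set X) (g : X -> R).
Hypotheses (mphi : measurable_fun setT phi) (mD : measurable D).
Hypotheses (mg : measurable_fun setT g) (g0 : forall x, 0 <= g x).
Hypothesis law_phi : forall A, measurable A ->
  (\int[m]_(x in D `&` phi @^-1` A) (g x)%:E = Q A)%E.

Import HBNNSimple.

(** [law_phi] says that [phi] carries the measure with density [g] on [D] to [Q], which is the
    identity for indicators. Linearity extends it to simple functions, and monotone convergence to
    [f]. The weight [g] lets it serve both for densities, with [phi] the identity, and for
    integrating one factor of a product. *)
Lemma ge0_integral_law (f : Y -> R) :
  measurable_fun setT f -> (forall y, 0 <= f y) ->
  (\int[m]_(x in D) (g x * f (phi x))%:E = \int[Q]_y (f y)%:E)%E.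
Proof.
move=> mf f0; have mEf : measurable_fun setT (EFin \o f) by exact/measurable_EFinP.
pose f_ := nnsfun_approx measurableT mEf.
have mfphi n : measurable_fun setT (fun x => f_ n (phi x)).
  by apply: measurableT_comp.
have mphiA A : measurable A -> measurable (phi @^-1` A).
  by move=> mA; rewrite -[X in measurable X]setTI; exact: mphi.
transitivity (limn (fun n => \int[Q]_y (f_ n y)%:E)%E); last first.
  rewrite -monotone_convergence//.
  - apply: eq_integral => y _; apply/cvg_lim => //.
    by apply: (@cvg_nnsfun_approx _ _ _ _ measurableT _ mEf) => // x _; rewrite lee_fin.
  - by move=> n; exact/measurable_EFinP/measurable_funP.
  - by move=> n y _; rewrite lee_fin.
  - by move=> y _ i j ij; rewrite lee_fin; exact/lefP/nd_nnsfun_approx.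
transitivity (limn (fun n => \int[m]_(x in D) (g x * f_ n (phi x))%:E)%E).
  rewrite -monotone_convergence//.
  - apply: eq_integral => x _; apply/esym/cvg_lim => //.
    have cf : EFin \o f_ ^~ (phi x) @ \oo --> (f (phi x))%:E.
      by apply: (@cvg_nnsfun_approx _ _ _ _ measurableT _ mEf) => // y _; rewrite lee_fin.
    rewrite EFinM; under eq_fun do rewrite EFinM.
    exact: cvgeZl.
  - move=> n; apply/measurable_EFinP/measurable_funTS; exact: measurable_funM.
  - by move=> n x _; rewrite lee_fin mulr_ge0.
  - move=> x _ i j ij; rewrite lee_fin ler_wpM2l//.
    exact/lefP/nd_nnsfun_approx.
congr (limn _); apply/funext => n.
have mfk k : measurable (f_ n @^-1` [set k]).
  by rewrite -[X in measurable X]setTI; exact: measurable_funP.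
transitivity (\sum_(k \in range (f_ n)) k%:E * Q (f_ n @^-1` [set k]))%E.
  transitivity (\sum_(k \in range (f_ n))
      \int[m]_(x in D) (k * (g x * \1_(f_ n @^-1` [set k]) (phi x)))%:E)%E.
    rewrite -ge0_integral_fsum//.
    - apply: eq_integral => x _; rewrite fsumEFin//; congr EFin.
      rewrite [in LHS]fimfunE [LHS]mulrC mulr_fsuml//.
      by apply: eq_fsbigr => k _; rewrite mulrAC mulrA.
    - move=> k; apply/measurable_EFinP/measurable_funTS.
      apply: measurable_funM => //; apply: measurable_funM => //.
      by apply: measurableT_comp.
    - move=> k x Dx; rewrite lee_fin mulrCA mulr_ge0//.
      by rewrite -lee_fin EFinM nnfun_muleindic_ge0.
  (* The approximant [f_ n] is nonnegative, so its fibre over a negative [k] is empty; pulling [k]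
     out of the integral below requires [k >= 0]. *)
  apply: eq_fsbigr => k _; have [k0|k0] := ltP k 0.
    rewrite preimage_nnfun0// measure0 mule0.
    by apply: integral0_eq => x _; rewrite indic0 !mulr0.
  under eq_integral do rewrite EFinM.
  rewrite ge0_integralZl_EFin//.
  - congr (_ * _)%E; rewrite -law_phi// integral_mkcondr.
    apply: eq_integral => x _; rewrite patchE indicE.
    by rewrite (_ : (x \in _) = (phi x \in f_ n @^-1` [set k])) //; case: ifP; rewrite ?mulr1 ?mulr0.
  - by move=> x _; rewrite lee_fin mulr_ge0.
  - apply/measurable_EFinP/measurable_funTS.
    apply: measurable_funM => //.
    by apply: measurableT_comp.
by rewrite integralT_nnsfun sintegralE.
Qed.

End change_of_variables.

Section weighted_measure.
Context d (T : measurableType d) (R : realType).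
Variables (m : {measure set T -> \bar R}) (D : set T) (g : T -> R).
Hypotheses (mD : measurable D) (mg : measurable_fun setT g).
Hypothesis g0 : forall x, 0 <= g x.

(* The hypotheses are arguments so that the measure instance can use them. *)
Definition weighted of measurable D & measurable_fun setT g &
    (forall x, 0 <= g x) := fun A : set T => (\int[m]_(x in D `&` A) (g x)%:E)%E.

Local Notation nu := (weighted mD mg g0).

Let weighted0 : nu set0 = 0%E.
Proof. by rewrite /weighted setI0 integral_set0. Qed.

Let weighted_ge0 A : (0 <= nu A)%E.
Proof. by apply: integral_ge0 => x _; rewrite lee_fin. Qed.

Let weighted_sigma_additive : semi_sigma_additive nu.
Proof.
move=> F mF tF mUF; rewrite /weighted setI_bigcupr ge0_integral_bigcup//.
- apply: is_cvg_ereal_nneg_natsum_cond => n _ _.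
  by apply: integral_ge0 => x _; rewrite lee_fin.
- by move=> k; exact: measurableI.
- exact/measurable_EFinP/measurable_funTS.
- by move=> x _; rewrite lee_fin.
- exact: trivIset_setIl.
Qed.

HB.instance Definition _ := isMeasure.Build _ _ _ nu
  weighted0 weighted_ge0 weighted_sigma_additive.

End weighted_measure.

Section product_law.
Context d d' (X : measurableType d) (Y : measurableType d') (R : realType).
Context (I : eqType).
Variables (Z : I -> X -> Y).
Hypothesis mZ : forall i, measurable_fun setT (Z i).

Definition rectangle (s : seq I) (A : I -> set Y) : set X :=
  \bigcap_(i in [set` s]) (Z i @^-1` A i).

Definition rectangles (s : seq I) : set (set X) :=
  [set rectangle s A | A in [set A | forall i, measurable (A i)]].

(** For probabilities [Q i] and duplicate-free [s]: [m] restricted to [D] has mass [c] and, up to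
    this mass, makes the [Z i] with [i] in [s] independent with laws [Q i]. *)
Definition product_law (m : {measure set X -> \bar R})
    (Q : I -> {measure set Y -> \bar R}) (s : seq I) (D : set X) (c : R) :=
  forall A, (forall i, measurable (A i)) ->
    m (D `&` rectangle s A) = (c%:E * \prod_(i <- s) Q i (A i))%E.

Lemma rectangle_cons i s A : rectangle (i :: s) A = Z i @^-1` A i `&` rectangle s A.
Proof.
apply/seteqP; split=> x.
  move=> sx; split; first by apply: sx; rewrite /= mem_head.
  by move=> j js; apply: sx; rewrite /= inE js orbT.
by move=> [ix sx] j; rewrite /= inE => /predU1P [->//|]; exact: sx.
Qed.

Lemma measurable_preimageT i A : measurable A -> measurable (Z i @^-1` A).
Proof. by move=> mA; rewrite -[X in measurable X]setTI; exact: mZ. Qed.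

(** Induction on [s], integrating out the head [i]: weighted by the other factors, [m] on [D] has
    image [c * p] times [Q i] under [Z i]. Evaluating this image at [A] is the induction hypothesis
    on [D] cut by the event that [Z i] lies in [A], which is why [D] and [c] vary in the
    induction. *)
Lemma integral_product_law m (Q : I -> probability Y R) s D c (f : I -> Y -> R) :
  uniq s -> measurable D -> 0 <= c ->
  product_law m Q s D c ->
  (forall i, measurable_fun setT (f i)) -> (forall i y, 0 <= f i y) ->
  (forall i, i \in s -> \int[Q i]_y (f i y)%:E < +oo)%E ->
  (\int[m]_(x in D) (\prod_(i <- s) f i (Z i x))%:E =
   c%:E * \prod_(i <- s) \int[Q i]_y (f i y)%:E)%E.
Proof.
move=> us mD c0 Hm mf f0 fy; elim: s us D mD c c0 Hm fy => [ _ D mD c c0 Hm _|i s IHs].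
  rewrite big_nil mule1; under eq_integral do rewrite big_nil.
  rewrite integral_cst// mul1e.
  have := Hm (fun=> setT) (fun=> measurableT); rewrite big_nil mule1 => <-.
  rewrite (_ : rectangle _ _ = setT) ?setIT//.
  by apply/seteqP; split.
move=> /= /andP[i_s us] D mD c c0 Hm fy.
have fin j : j \in i :: s -> (\int[Q j]_y (f j y)%:E \is a fin_num)%E.
  move=> js; rewrite ge0_fin_numE ?fy//.
  by apply: integral_ge0 => y _; rewrite lee_fin.
set p := (\prod_(j <- s) \int[Q j]_y (f j y)%:E)%E.
have pfin : p \is a fin_num.
  rewrite /p big_seq; elim/big_ind : _ => //.
    by move=> x y; exact: fin_numM.
  by move=> j js; apply: fin; rewrite inE js orbT.
have p0 : (0 <= p)%E.
  rewrite /p; elim/big_ind : _ => //.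
    by move=> x y; exact: mule_ge0.
  by move=> j _; apply: integral_ge0 => y _; rewrite lee_fin.
have k0 : 0 <= c * fine p by rewrite mulr_ge0// fine_ge0.
transitivity (\int[mscale (NngNum k0) (Q i)]_y (f i y)%:E)%E; last first.
  rewrite ge0_integral_mscale//.
  - by rewrite big_cons /= EFinM fineK// -muleA [(p * _)%E]muleC.
  - exact/measurable_EFinP.
  - by move=> y _; rewrite lee_fin.
rewrite -(@ge0_integral_law _ _ _ _ _ m _ (Z i) D (fun x => \prod_(j <- s) f j (Z j x)))//.
- by apply: eq_integral => x _; rewrite big_cons mulrC.
- apply: measurable_prod => j _; exact: measurableT_comp.
- by move=> x; apply: prodr_ge0.
move=> A mA; transitivity ((c * fine p)%:E * Q i A)%E => //.
have QA : Q i A = (fine (Q i A))%:E by rewrite fineK// fin_num_measure.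
rewrite (IHs us _ _ (c * fine (Q i A)))//.
- by rewrite -/p !EFinM -QA fineK// muleAC.
- by apply: measurableI => //; exact: measurable_preimageT.
- by rewrite mulr_ge0// fine_ge0.
- move=> B mB.
  (* With [A] placed at [i], the cut of [D] by [Z i] joins the rectangle of the tail into one over
     [i :: s]; the other sides are unchanged because [i] is not in [s]. *)
  pose B' j := if j == i then A else B j.
  have mB' j : measurable (B' j) by rewrite /B'; case: ifP.
  have eqB' : {in s, forall j, B' j = B j}.
    by move=> j js; rewrite /B'; case: eqP i_s => // <-; rewrite js.
  rewrite EFinM -QA -muleA.
  have -> : (D `&` Z i @^-1` A `&` rectangle s B = D `&` rectangle (i :: s) B')%classic.
    rewrite rectangle_cons {1}/B' eqxx setIA; congr (_ `&` _).
    by apply: eq_bigcapr => j js /=; rewrite eqB'.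
  rewrite Hm// big_cons {1}/B' eqxx; congr (_ * (_ * _))%E.
  by rewrite !big_seq; apply: eq_bigr => j js; rewrite eqB'.
- by move=> j js; apply: fy; rewrite inE js orbT.
Qed.

Lemma measurable_rectangle s A :
  (forall i, measurable (A i)) -> measurable (rectangle s A).
Proof.
move=> mA; apply: fin_bigcap_measurable => // i _; exact: measurable_preimageT.
Qed.

Lemma rectangleI s A B :
  rectangle s A `&` rectangle s B = rectangle s (fun i => A i `&` B i).
Proof. by rewrite /rectangle -bigcapI. Qed.

Lemma prod_indic_rectangle s A x :
  \prod_(i <- s) \1_(A i) (Z i x) = \1_(rectangle s A) x :> R.
Proof.
elim: s => [|i s IHs].
  by rewrite big_nil indicE mem_set//.
by rewrite big_cons IHs rectangle_cons indicI.
Qed.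

(** Densities multiply over independent coordinates. Both sides are finite measures in [B]; they
    agree on rectangles by [integral_product_law] applied to [f i] times an indicator, and
    rectangles are stable under intersection, so they agree on the generated sigma-algebra. *)
Lemma product_law_density (m1 m2 : {measure set X -> \bar R})
    (Q1 Q2 : I -> probability Y R) s D1 D2 c (f : I -> Y -> R) :
  uniq s -> measurable D1 -> measurable D2 -> 0 <= c ->
  product_law m1 Q1 s D1 c -> product_law m2 Q2 s D2 c ->
  (forall i, measurable_fun setT (f i)) -> (forall i y, 0 <= f i y) ->
  (forall i A, measurable A -> Q1 i A = \int[Q2 i]_(y in A) (f i y)%:E)%E ->
  forall B, <<s rectangles s >> B ->
    (m1 (D1 `&` B) =
     \int[m2]_(x in D2 `&` B) (\prod_(i <- s) f i (Z i x))%:E)%E.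
Proof.
move=> us mD1 mD2 c0 law1 law2 mf f0 dens B sB.
have mp : measurable_fun setT (fun x => \prod_(i <- s) f i (Z i x)).
  by apply: measurable_prod => i _; exact: measurableT_comp.
have p0 x : 0 <= \prod_(i <- s) f i (Z i x) by apply: prodr_ge0.
have : mrestr m1 mD1 B = weighted m2 mD2 mp p0 B; last first.
  by rewrite /mrestr setIC.
apply: (g_sigma_algebra_measure_unique (rectangles s) _ (fun=> setT)) => //.
- by move=> _ [A mA <-]; exact: measurable_rectangle.
- move=> _; exists (fun=> setT) => //.
  by apply/seteqP; split.
- by apply/seteqP; split => // x _; exists 0%N.
- move=> _ _ [A1 mA1 <-] [A2 mA2 <-]; rewrite rectangleI.
  by eexists; last reflexivity; move=> i; exact: measurableI.
- move=> _ [A mA <-]; transitivity (m1 (D1 `&` rectangle s A)).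
    by rewrite setIC.
  rewrite law1// [RHS]integral_mul_indic.
  rewrite (eq_integral (fun x => (\prod_(i <- s) (f i (Z i x) * \1_(A i) (Z i x)))%:E)).
    rewrite (@integral_product_law m2 Q2 s D2 c (fun i y => f i y * \1_(A i) y))//.
    + congr (_ * _)%E; apply: eq_bigr => i _.
      apply: (etrans (dens i (A i) (mA i))).
      by rewrite -[A i in LHS]setTI integral_mul_indic.
    + by move=> i; apply: measurable_funM.
    + by move=> i y; rewrite mulr_ge0.
    + move=> i _.
      have -> : (\int[Q2 i]_y (f i y * \1_(A i) y)%:E = Q1 i (A i))%E.
        by rewrite dens// -[A i in RHS]setTI integral_mul_indic.
      by rewrite (le_lt_trans (probability_le1 _ _))// ltry.
  by move=> x _; rewrite big_split/= prod_indic_rectangle.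
- move=> _; suff : (m1 (D1 `&` setT) < +oo)%E by rewrite setIC.
  have := law1 (fun=> setT) (fun=> measurableT).
  rewrite big1 => [|i _]; last exact: probability_setT.
  by rewrite mule1 (_ : rectangle _ _ = setT) ?setIT => [->|]; [rewrite ltry|apply/seteqP; split].
Qed.

Lemma measurable_rectangles s i (U : set Y) :
  i \in s -> measurable U -> <<s rectangles s >> (Z i @^-1` U).
Proof.
move=> i_s mU; apply: sub_sigma_algebra.
exists (fun j => if j == i then U else setT).
  by move=> j; case: ifP.
apply/seteqP; split => x.
  by move=> /(_ i i_s); rewrite /= eqxx.
by move=> Ux j js /=; case: eqP => // ->.
Qed.

End product_law.

(** * Densities and mixtures *)

Lemma measurable_fun_eq d (T : measurableType d) (R : realType) (f : T -> R) (r : R) :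
  measurable_fun setT f -> measurable [set x | f x = r].
Proof.
move=> mf; rewrite (_ : [set x | _] = setT `&` f @^-1` [set r]).
  by apply: mf => //; exact: measurable_set1.
by rewrite setTI.
Qed.

Lemma measurable_fun_gt0 d (T : measurableType d) (R : realType) (f : T -> R) :
  measurable_fun setT f -> measurable [set x | 0 < f x].
Proof.
move=> mf; rewrite (_ : [set x | _] = setT `&` f @^-1` `]0, +oo[%classic).
  exact: mf.
by rewrite setTI; apply/seteqP; split => x /=; rewrite in_itv/= andbT.
Qed.

(** Inversion is continuous on the open complement of 0; the point 0, where it takes the default
    value 0, is treated apart. *)
Lemma measurable_invr (R : realType) : measurable_fun [set: R] (@GRing.inv R).
Proof.
rewrite -(setUv [set 0 : R]); apply/measurable_funU => //.
  exact: measurableC.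
split.
  have : measurable_fun [set 0 : R] (fun=> 0 : R) by exact: measurable_cst.
  by apply: eq_measurable_fun => x; rewrite inE => ->; rewrite invr0.
apply: open_continuous_measurable_fun.
  by apply: closed_openC; exact: closed_eq.
by move=> x; rewrite inE => /eqP x0; exact: inv_continuous.
Qed.

Section mixture.
Context d (T : measurableType d) (R : realType).
Variables (p : R) (P Q : probability T R).
Hypotheses (p0 : 0 <= p) (p1 : p <= 1).

Definition mixture of 0 <= p & p <= 1 := fun A => (p%:E * P A + (1 - p)%:E * Q A)%E.

Local Notation nu := (mixture p0 p1).

Let q0 : 0 <= 1 - p. Proof. by rewrite subr_ge0. Qed.

Let nuE : nu = measure_add (mscale (NngNum p0) P) (mscale (NngNum q0) Q).
Proof. by apply/funext => A; rewrite measure_addE. Qed.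

Let mixture0 : nu set0 = 0%E. Proof. by rewrite nuE; exact: measure0. Qed.

Let mixture_ge0 A : (0 <= nu A)%E. Proof. by rewrite nuE; exact: measure_ge0. Qed.

Let mixture_sigma_additive : semi_sigma_additive nu.
Proof. by rewrite nuE; exact: measure_semi_sigma_additive. Qed.

HB.instance Definition _ := isMeasure.Build _ _ _ nu
  mixture0 mixture_ge0 mixture_sigma_additive.

Let mixture_setT : nu setT = 1%E.
Proof. by rewrite /mixture !probability_setT !mule1 -EFinD addrC subrK. Qed.

HB.instance Definition _ := Measure_isProbability.Build _ _ _ nu mixture_setT.

Lemma ge0_integral_mixture A (f : T -> \bar R) : measurable A ->
  measurable_fun setT f -> (forall x, 0 <= f x)%E ->
  (\int[nu]_(x in A) f x =
   p%:E * \int[P]_(x in A) f x + (1 - p)%:E * \int[Q]_(x in A) f x)%E.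
Proof.
move=> mA mf f0.
rewrite (eq_measure_integral
  (measure_add (mscale (NngNum p0) P) (mscale (NngNum q0) Q))); last first.
  by move=> B _ _; rewrite [RHS]measure_addE.
have mfA : measurable_fun A f by exact: measurable_funTS.
by rewrite ge0_integral_measure_add// !ge0_integral_mscale.
Qed.

End mixture.

Section density.
Context d (T : measurableType d) (R : realType).
Variables (mu P : {measure set T -> \bar R}) (rho : T -> R).
Hypotheses (mrho : measurable_fun setT rho) (rho0 : forall x, 0 <= rho x).
Hypothesis PE : forall A, measurable A -> P A = (\int[mu]_(x in A) (rho x)%:E)%E.

Lemma ge0_integral_density A (f : T -> R) : measurable A ->
  measurable_fun setT f -> (forall x, 0 <= f x) ->
  (\int[P]_(x in A) (f x)%:E = \int[mu]_(x in A) (rho x * f x)%:E)%E.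
Proof.
move=> mA mf f0; rewrite -[in LHS](setTI A) -[in RHS](setTI A) !integral_mul_indic.
rewrite -(@ge0_integral_law _ _ _ _ _ mu _ idfun setT rho)//.
- by apply: eq_integral => x _; rewrite mulrA.
- exact: measurable_id.
- by move=> B mB; rewrite setTI; exact/esym/PE.
- exact: measurable_funM.
- by move=> x; rewrite mulr_ge0.
Qed.

End density.

Lemma ge0_integral_eq0_null d (T : measurableType d) (R : realType)
    (m : {measure set T -> \bar R}) (D : set T) (f : T -> R) :
  measurable D -> measurable_fun setT f -> (forall x, D x -> 0 <= f x) ->
  (\int[m]_(x in D) (f x)%:E = 0)%E -> m (D `&` [set x | f x != 0]) = 0%E.
Proof.
move=> mD mf f0 intf.
have mEf : measurable_fun D (EFin \o f) by exact/measurable_EFinP/measurable_funTS.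
have : (\int[m]_(x in D) `|(EFin \o f) x| = 0)%E.
  rewrite -[RHS]intf; apply: eq_integral => x; rewrite inE => Dx.
  by rewrite /= ger0_norm ?f0.
move=> /(ae_eq_integral_abs m mD mEf) [N [mN N0 subN]].
apply: (subset_measure0 _ mN _ N0).
  apply: measurableI => //.
  rewrite (_ : [set x | _] = setT `&` f @^-1` (~` [set 0])).
    by apply: mf => //; exact: measurableC.
  by rewrite setTI; apply/seteqP; split => x /= /eqP.
by move=> x [Dx /= /eqP fx]; apply: subN => /= h; apply: fx; exact: (EFin_inj (h Dx)).
Qed.

Lemma measurable_psi (R : realType) n (rhop rhom : n.-tuple R -> R) :
  measurable_fun setT rhop -> measurable_fun setT rhom ->
  measurable_fun setT (psi rhop rhom).
Proof.
move=> mp mm; apply: measurable_funM => //.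
by apply: measurableT_comp => //; exact: measurable_invr.
Qed.

(** * Laws of the features *)

Section features.
Context {R : realType} {n : nat}.
Local Notation Rn := (n.-tuple R).
Variables (mu : {measure set Rn -> \bar R}) (rhop rhom : Rn -> R).
Variables (Pp Pm : probability Rn R).
Hypothesis a1 : assumption1 mu rhop rhom Pp Pm.

Local Notation t := (tstat rhop rhom).
Local Notation law := (law_of Pp Pm).

Definition rho_of (s : bool) : Rn -> R := if s then rhop else rhom.

Lemma rho_of_density s : is_density mu (rho_of s) (law s).
Proof. by case: a1 => _ _ dp dm _; case: s. Qed.

Lemma rho_of_ge0 s x : 0 <= rho_of s x.
Proof. by have [_ + _] := rho_of_density s; exact. Qed.

Lemma measurable_rho_of s : measurable_fun setT (rho_of s).
Proof. by have [] := rho_of_density s. Qed.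

Let rhop0 x : 0 <= rhop x. Proof. exact: (rho_of_ge0 true). Qed.
Let rhom0 x : 0 <= rhom x. Proof. exact: (rho_of_ge0 false). Qed.
Let mrhop : measurable_fun setT rhop. Proof. exact: (measurable_rho_of true). Qed.
Let mrhom : measurable_fun setT rhom. Proof. exact: (measurable_rho_of false). Qed.

Lemma measurable_tstat : measurable_fun setT t.
Proof.
apply: measurable_funM; first exact: measurable_funB.
by apply: measurableT_comp; [exact: measurable_invr|exact: measurable_funD].
Qed.

Lemma measurable_Mstat gam k : measurable_fun setT (Mstat gam rhop rhom k).
Proof.
have mu_ : measurable_fun setT (fun x => gam ^+ k * t x).
  by apply: measurable_funM => //; exact: measurable_tstat.
apply: measurable_funM => //; apply: measurable_funM => //.
apply: measurableT_comp => //; apply: measurable_funM.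
  exact: measurable_funD.
by apply: measurableT_comp; [exact: measurable_invr|exact: measurable_funB].
Qed.

(** A law does not charge the zeros of its own density; mutual absolute continuity transfers this to
    the other law. *)
Lemma law_rho_of_eq0 s s' : law s [set x | rho_of s' x = 0] = 0%E.
Proof.
have [ab ba _ _ _] := a1; have [mr _ lawE] := rho_of_density s'.
have ms : measurable [set x | rho_of s' x = 0] by exact: measurable_fun_eq.
have h : law s' [set x | rho_of s' x = 0] = 0%E.
  by rewrite lawE//; apply: integral0_eq => x /= ->.
move/null_content_dominatesP : ab => ab; move/null_content_dominatesP : ba => ba.
by case: s s' h ms {mr lawE} => -[] //= h ms; [apply: ab|apply: ba].
Qed.

(** The exceptional set of all density identities below: off it the two densities are both positive
    or both zero. *)
Definition one_sided := [set x | (rhop x == 0) != (rhom x == 0)].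

Lemma measurable_one_sided : measurable one_sided.
Proof.
have m0 s : measurable [set x | rho_of s x = 0].
  by apply: measurable_fun_eq; exact: measurable_rho_of.
rewrite (_ : one_sided = ([set x | rho_of true x = 0] `\` [set x | rho_of false x = 0])
  `|` ([set x | rho_of false x = 0] `\` [set x | rho_of true x = 0])).
  by apply: measurableU; apply: measurableD.
apply/seteqP; split => x; rewrite /one_sided/=.
  have [->|/eqP p] := eqVneq (rhop x) 0; have [->|/eqP q] := eqVneq (rhom x) 0;
    rewrite ?eqxx//= => _; by [left; split|right; split].
by case=> -[-> /eqP/negPf ->]; rewrite eqxx.
Qed.

(** Each density has integral 0 over the zeros of the other by [law_rho_of_eq0], so it vanishes
    [mu]-almost everywhere there. *)
Lemma mu_one_sided : mu one_sided = 0%E.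
Proof.
have m0 s : measurable [set x | rho_of s x = 0].
  by apply: measurable_fun_eq; exact: measurable_rho_of.
have h s : mu ([set x | rho_of s x = 0] `&` [set x | rho_of (~~ s) x != 0]) = 0%E.
  apply: ge0_integral_eq0_null => //.
  - exact: measurable_rho_of.
  - by move=> x _; exact: rho_of_ge0.
  - have [_ _ <-//] := rho_of_density (~~ s); exact: law_rho_of_eq0.
have mS s : measurable ([set x | rho_of s x = 0] `&` [set x | rho_of (~~ s) x != 0]).
  apply: measurableI => //.
  rewrite (_ : [set x | _ != _] = ~` [set x | rho_of (~~ s) x = 0]).
    exact: measurableC.
  by apply/seteqP; split => x /= /eqP.
apply: (subset_measure0 measurable_one_sided (measurableU _ _ (mS true) (mS false))).
  move=> x; rewrite /one_sided/=.
  have [->|p] := eqVneq (rhop x) 0; have [->|q] := eqVneq (rhom x) 0;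
    rewrite ?eqxx//= => _; by [left; split|right; split].
apply/eqP; rewrite -measure_le0.
apply: (le_trans (measureU2 _ (mS true) (mS false))).
by rewrite [X in (X + _)%E](h true) [X in (_ + X)%E](h false) adde0.
Qed.

Section mixed_law.
Variables (gam : R) (k : nat).
Hypotheses (gam0 : 0 < gam) (gam1 : gam < 1).

Let gk0 : 0 < gam ^+ k. Proof. exact: exprn_gt0. Qed.
Let gk1 : gam ^+ k <= 1. Proof. by apply: exprn_ile1; exact: ltW. Qed.

Lemma agree_ge0 : 0 <= (1 + gam ^+ k) / 2.
Proof. by rewrite divr_ge0// addr_ge0// ltW. Qed.

Lemma agree_le1 : (1 + gam ^+ k) / 2 <= 1.
Proof. by rewrite ler_pdivrMr// mul1r lerD2l. Qed.

(** The law of a feature at depth [k] given the root label [s]: after [k] broadcast steps the label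
    agrees with the root with probability (1 + gam^k)/2. *)
Definition mixed_law s : probability Rn R :=
  mixture (law s) (law (~~ s)) agree_ge0 agree_le1.

Definition mixed_rho s (x : Rn) : R :=
  (1 + gam ^+ k) / 2 * rho_of s x + (1 - (1 + gam ^+ k) / 2) * rho_of (~~ s) x.

Lemma integral_mixed_law s (A : set Rn) (f : Rn -> R) : measurable A -> measurable_fun setT f ->
  (forall x, 0 <= f x) ->
  (\int[mixed_law s]_(x in A) (f x)%:E =
   \int[mu]_(x in A) (mixed_rho s x * f x)%:E)%E.
Proof.
move=> mA mf f0.
have mrf s' : measurable_fun A (fun x => (rho_of s' x * f x)%:E).
  apply/measurable_EFinP/measurable_funTS/measurable_funM => //.
  exact: measurable_rho_of.
have rf0 s' x : A x -> (0 <= (rho_of s' x * f x)%:E)%E.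
  by rewrite lee_fin mulr_ge0// rho_of_ge0.
rewrite ge0_integral_mixture//; last exact/measurable_EFinP.
have densE s' : (\int[law s']_(x in A) (f x)%:E =
    \int[mu]_(x in A) (rho_of s' x * f x)%:E)%E.
  by have [mr r0 lawE] := rho_of_density s'; exact: ge0_integral_density.
rewrite !densE.
rewrite -!ge0_integralZl_EFin ?subr_ge0 ?agree_ge0 ?agree_le1//; try exact: rf0.
rewrite -ge0_integralD//.
- by apply: eq_integral => x _; rewrite -!EFinM -EFinD /mixed_rho; congr EFin; ring.
- by move=> x Ax; rewrite mule_ge0 ?rf0// lee_fin agree_ge0.
- exact: measurable_funeM.
- by move=> x Ax; rewrite mule_ge0 ?rf0// lee_fin subr_ge0 agree_le1.
- exact: measurable_funeM.
Qed.

(** With p, q the two densities at [x] and u = gam^k t, the mixed densities are (p + q)(1 + u)/2 and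
    (p + q)(1 - u)/2, and their ratio is exp(2 artanh u). If p and q are both positive then 1 + u
    and 1 - u are positive, even for gam^k = 1; if both vanish, both sides are 0. *)
Lemma expR_Mstat_mixed_rho x : ~ one_sided x ->
  mixed_rho true x = mixed_rho false x * expR (Mstat gam rhop rhom k x).
Proof.
rewrite /one_sided /mixed_rho /Mstat /artanh /tstat /rho_of /= => /negP.
rewrite negbK => /eqP h; have [p0|p0] := eqVneq (rhop x) 0.
  have q0 : rhom x = 0 by apply/eqP; rewrite -h p0 eqxx.
  by rewrite p0 q0 !mulr0 addr0 mul0r.
have xp : 0 < rhop x by rewrite lt_neqAle eq_sym p0 rhop0.
have xm : 0 < rhom x by rewrite lt_neqAle eq_sym -h p0 rhom0.
move: h p0 => _ _.
move: gk0 gk1; move: (gam ^+ k) (rhop x) (rhom x) xp xm => g p q p0 q0 g0 g1.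
set u := g * _; have pq : 0 < p + q by rewrite addr_gt0.
have uE : u * (p + q) = g * (p - q) by rewrite /u -mulrA divfK// gt_eqF.
have u1 : 0 < 1 + u.
  rewrite -(pmulr_lgt0 _ pq) mulrDl uE.
  by have := mulr_gt0 g0 p0; have : 0 <= (1 - g) * q; [rewrite mulr_ge0 ?subr_ge0// ltW|lra].
have u2 : 0 < 1 - u.
  rewrite -(pmulr_lgt0 _ pq) mulrBl uE.
  by have := mulr_gt0 g0 q0; have : 0 <= (1 - g) * p; [rewrite mulr_ge0 ?subr_ge0// ltW|lra].
rewrite [2 * _]mulrC divfK ?pnatr_eq0// lnK ?posrE ?divr_gt0// mulrA.
have -> : (1 + g) / 2 * p + (1 - (1 + g) / 2) * q = (p + q) * (1 + u) / 2.
  by transitivity ((p + q + u * (p + q)) / 2); [rewrite uE; field|field].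
have -> : (1 + g) / 2 * q + (1 - (1 + g) / 2) * p = (p + q) * (1 - u) / 2.
  by transitivity ((p + q - u * (p + q)) / 2); [rewrite uE; field|field].
by field; rewrite gt_eqF.
Qed.

(** Once both sides are integrals against [mu], the integrands agree off the null set
    [one_sided]. *)
Lemma mixed_law_tilt (A : set Rn) : measurable A ->
  (mixed_law true A =
   \int[mixed_law false]_(x in A) (expR (Mstat gam rhop rhom k x))%:E)%E.
Proof.
move=> mA.
have mM : measurable_fun setT (fun x => expR (Mstat gam rhop rhom k x)).
  by apply: measurableT_comp => //; exact: measurable_Mstat.
have mm s : measurable_fun setT (mixed_rho s).
  by apply: measurable_funD; apply: measurable_funM => //; exact: measurable_rho_of.
have m0 s x : 0 <= mixed_rho s x.
  by rewrite addr_ge0// mulr_ge0 ?rho_of_ge0 ?subr_ge0 ?agree_ge0 ?agree_le1.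
rewrite integral_mixed_law//.
transitivity (\int[mixed_law true]_(x in A) (1 : R)%:E)%E.
  by rewrite integral_cst// mul1e.
rewrite (@integral_mixed_law true A (fun=> 1))//.
apply: ge0_ae_eq_integral => //.
- exact/measurable_EFinP/measurable_funTS/measurable_funM.
- exact/measurable_EFinP/measurable_funTS/measurable_funM.
- by move=> x _; rewrite lee_fin mulr1.
- by move=> x _; rewrite lee_fin mulr_ge0// expR_ge0.
- exists one_sided; split; [exact: measurable_one_sided|exact: mu_one_sided|].
  move=> x /= h; apply: contrapT => /expR_Mstat_mixed_rho xE.
  by apply: h => _; rewrite mulr1 xE.
Qed.

End mixed_law.
End features.

(** * Error probability of the sign of [t] at a single feature *)

Section feature_error.
Context {R : realType} {n : nat}.
Local Notation Rn := (n.-tuple R).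
Variables (mu : {measure set Rn -> \bar R}) (rhop rhom : Rn -> R).
Variables (Pp Pm : probability Rn R).
Hypothesis a1 : assumption1 mu rhop rhom Pp Pm.

Local Notation t := (tstat rhop rhom).
Local Notation law := (law_of Pp Pm).
Local Notation rho_of := (rho_of rhop rhom).

Let rhop0 x : 0 <= rhop x. Proof. exact: (rho_of_ge0 a1 true). Qed.
Let rhom0 x : 0 <= rhom x. Proof. exact: (rho_of_ge0 a1 false). Qed.
Let mrhop : measurable_fun setT rhop. Proof. exact: (measurable_rho_of a1 true). Qed.
Let mrhom : measurable_fun setT rhom. Proof. exact: (measurable_rho_of a1 false). Qed.

Lemma tstat_gt0 x : (0 < t x) = (rhom x < rhop x).
Proof.
(* If the denominator is 0, both densities vanish and [t x] is 0 too, so both comparisons are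
   false. *)
rewrite /tstat; have [x0|x0] := eqVneq (rhop x + rhom x) 0.
  have /andP[/eqP -> /eqP ->] : (rhop x == 0) && (rhom x == 0).
    by rewrite -paddr_eq0// x0 eqxx.
  by rewrite subr0 mul0r !ltxx.
by rewrite pmulr_lgt0 ?subr_gt0// invr_gt0 lt_neqAle eq_sym x0 addr_ge0.
Qed.

Lemma tstat_lt0 x : (t x < 0) = (rhop x < rhom x).
Proof.
rewrite /tstat; have [x0|x0] := eqVneq (rhop x + rhom x) 0.
  have /andP[/eqP -> /eqP ->] : (rhop x == 0) && (rhom x == 0).
    by rewrite -paddr_eq0// x0 eqxx.
  by rewrite subr0 mul0r !ltxx.
by rewrite pmulr_llt0 ?subr_lt0// invr_gt0 lt_neqAle eq_sym x0 addr_ge0.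
Qed.

Let mpos : measurable [set x | 0 < t x].
Proof. by apply: measurable_fun_gt0; exact: (measurable_tstat a1). Qed.

Let mneg : measurable [set x | t x < 0].
Proof.
rewrite (_ : [set x | _] = [set x | 0 < - t x]).
  apply: measurable_fun_gt0; apply: measurableT_comp => //.
  exact: (measurable_tstat a1).
by apply/seteqP; split => x /=; rewrite oppr_gt0.
Qed.

Definition wrong_sign s : set Rn := [set x | (0 < t x) != s].

Lemma measurable_wrong_sign s : measurable (wrong_sign s).
Proof.
rewrite (_ : wrong_sign s = if s then ~` [set x | 0 < t x] else [set x | 0 < t x]).
  by case: s => //; exact: measurableC.
by case: s; apply/seteqP; split => x; rewrite /wrong_sign/=; case: (0 < t x).
Qed.

(** The involution preserves [mu] and exchanges the two densities almost everywhere, hence turns [t]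
    into its opposite. *)
Lemma law_swap : law false [set x | 0 < t x] = law true [set x | t x < 0].
Proof.
have [_ _ [_ _ PpE] [_ _ PmE] [tau [mtau tauK tauP] rhoE]] := a1.
rewrite /= PpE// PmE// -[X in integral _ X]setTI -[X in _ = integral _ X _]setTI.
rewrite !integral_mul_indic.
pose F x : R := rhom x * \1_[set x | 0 < t x] x.
have mF : measurable_fun setT (EFin \o F).
  by apply/measurable_EFinP/measurable_funM.
transitivity (\int[mu]_x (F (tau x))%:E)%E.
  transitivity (\int[pushforward mu tau]_x (F x)%:E)%E.
    by apply: eq_measure_integral => A mA _; exact/esym/tauP.
  rewrite (ge0_integral_pushforward mtau)//.
  by move=> x _; rewrite lee_fin mulr_ge0.
have mFtau : measurable_fun setT (fun x => (F (tau x))%:E).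
  exact: (measurableT_comp mF mtau).
have mG : measurable_fun setT (fun x => (rhop x * \1_[set x | t x < 0] x)%:E).
  by apply/measurable_EFinP/measurable_funM.
apply: ge0_ae_eq_integral => //.
- by move=> x _; rewrite lee_fin mulr_ge0.
- by move=> x _; rewrite lee_fin mulr_ge0.
have [N [mN N0 subN]] := rhoE.
have mtN : measurable (tau @^-1` N) by rewrite -[X in measurable X]setTI; exact: mtau.
(* The almost-sure relation is used both at [x] and at [tau x], so [N] and its preimage, null by
   invariance of [mu], are both discarded. *)
exists (N `|` tau @^-1` N); split.
- exact: measurableU.
- apply/eqP; rewrite -measure_le0 (le_trans (measureU2 _ mN mtN))//.
  by rewrite [X in (_ + X)%E](etrans (tauP N mN) N0) [X in (X + _)%E]N0 adde0.
- move=> x /= h; apply: contrapT => /not_orP[Nx Nx']; apply: h => _.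
  have e1 : rhom x = rhop (tau x) by apply: contrapT => h; apply: Nx; exact: subN.
  have e2 : rhom (tau x) = rhop x.
    by apply: contrapT => h; apply: Nx'; apply: subN => /=; rewrite tauK.
  rewrite /F e2 !indicE; congr (_ * (nat_of_bool _)%:R)%:E.
  by apply/idP/idP; rewrite !inE /= tstat_gt0 tstat_lt0 e2 -e1.
Qed.

(** The minimum of the densities is [rhom] where [t] is positive and [rhop] elsewhere, so its
    integral is the sum of the two error probabilities of the sign of [t]. *)
Lemma tau_featE :
  tau_feat mu rhop rhom =
  1 - fine (law true [set x | t x <= 0]) - fine (law false [set x | 0 < t x]).
Proof.
rewrite /tau_feat /eps_feat mulrA mulfV ?pnatr_eq0// mul1r -addrA -opprD.
have [_ _ [_ _ PpE] [_ _ PmE] _] := a1.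
have -> : [set x | t x <= 0] = ~` [set x | 0 < t x].
  by apply/seteqP; split => x /=; rewrite leNgt => /negP.
congr (1 - _); rewrite -fineD ?fin_num_measure//; last exact: measurableC.
congr fine; rewrite PpE; last exact: measurableC.
rewrite PmE// -(setvU [set x | 0 < t x]) ge0_integral_setU//.
- congr (_ + _)%E; apply: eq_integral => x; rewrite inE/= => tx.
    congr EFin; apply/min_idPl; rewrite leNgt -tstat_gt0; exact/negP.
  by congr EFin; apply/min_idPr/ltW; rewrite -tstat_gt0.
- exact: measurableC.
- by rewrite setvU; apply/measurable_EFinP/measurable_minr.
- by move=> x _; rewrite lee_fin le_min rhop0 rhom0.
- by rewrite disj_set2E setICl.
Qed.

(** Where the density ratio lies between (1 - delta)/(1 + delta) and its inverse, either density is
    at least (1 - delta) times the average of the two. So neither label can be recognised there with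
    error much below 1/2. *)
Lemma balanced_near0_le (delta : R) s A : 0 < delta -> delta < 1 ->
  measurable A ->
  A `<=` [set x | `|ln (psi rhop rhom x)| <= ln ((1 + delta) / (1 - delta))] ->
  ((1 - delta)%:E * balanced Pp Pm A <= law s A)%E.
Proof.
move=> d0 d1 mA AW; have [_ _ PsE] := rho_of_density a1 s.
have [_ _ [_ _ PpE] [_ _ PmE] _] := a1.
have mrs := measurable_rho_of a1 s.
rewrite /balanced PpE// PmE// PsE// -ge0_integralD//; first last.
- exact/measurable_EFinP/measurable_funTS.
- by move=> x _; rewrite lee_fin.
- exact/measurable_EFinP/measurable_funTS.
- by move=> x _; rewrite lee_fin.
rewrite muleA -EFinM -ge0_integralZl_EFin//; first last.
- by rewrite mulr_ge0// subr_ge0 ltW.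
- by apply: emeasurable_funD; exact/measurable_EFinP/measurable_funTS.
- by move=> x _; rewrite -EFinD lee_fin addr_ge0.
apply: ae_ge0_le_integral => //.
- move=> x _; rewrite -EFinD -EFinM lee_fin; apply: mulr_ge0.
    by rewrite mulr_ge0// subr_ge0 ltW.
  by rewrite addr_ge0.
- apply: measurable_funeM.
  by apply: emeasurable_funD; exact/measurable_EFinP/measurable_funTS.
- by move=> x _; rewrite lee_fin (rho_of_ge0 a1).
- exact/measurable_EFinP/measurable_funTS.
(* On [one_sided] the default values of division and [ln] give [ln (psi rhop rhom x) = 0] although
   one density vanishes, so the pointwise bound can fail; this set is null. *)
exists (one_sided rhop rhom); split;
  [exact: measurable_one_sided a1|exact: mu_one_sided a1|].
move=> x /= h; apply: contrapT => /negP; rewrite negbK => /eqP pq0; apply: h.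
move=> /AW /=; rewrite -EFinD -EFinM lee_fin.
have [p0|p0] := eqVneq (rhop x) 0.
  have q0 : rhom x = 0 by apply/eqP; rewrite -pq0 p0 eqxx.
  by move=> _; rewrite p0 q0 addr0 mulr0 (rho_of_ge0 a1).
have xp : 0 < rhop x by rewrite lt_neqAle eq_sym p0 rhop0.
have xm : 0 < rhom x by rewrite lt_neqAle eq_sym -pq0 p0 rhom0.
have d1' : 0 < 1 - delta by rewrite subr_gt0.
have d2' : 0 < 1 + delta by rewrite addr_gt0.
rewrite ler_norml -lnV ?posrE ?divr_gt0// invf_div /psi.
rewrite !ler_ln ?posrE ?divr_gt0// => /andP[].
rewrite ler_pdivrMr// mulrAC ler_pdivlMr// => h1.
rewrite ler_pdivrMr// mulrAC ler_pdivlMr// => h2.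
by case: s {PsE mrs}; rewrite /=; lra.
Qed.

Hypothesis tie : forall s, law s [set x | t x = 0] = 0%E.

Let law_ge0E s : law s [set x | t x <= 0] = law s [set x | t x < 0].
Proof.
rewrite (_ : [set x | t x <= 0] = [set x | t x < 0] `|` [set x | t x = 0]).
  apply: measureU0 => //; last exact: tie.
  by apply: measurable_fun_eq; exact: (measurable_tstat a1).
apply/seteqP; split => x /=; rewrite le_eqVlt.
  by move=> /orP[/eqP|]; [right|left].
by move=> [->|->]; rewrite ?eqxx ?orbT.
Qed.

(** By [law_swap] and the nullity of ties, both labels have the same error probability, and the two
    add up to 1 - tau_feat. *)
Lemma law_wrong_sign s :
  law s (wrong_sign s) = ((1 - tau_feat mu rhop rhom) / 2)%:E.
Proof.
have := tau_featE; rewrite law_ge0E -law_swap => ->.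
rewrite (_ : law s _ = law false [set x | 0 < t x]).
  rewrite -{1}(@fineK _ (law _ _)) ?fin_num_measure//; congr EFin.
  by field.
case: s.
  rewrite law_swap -law_ge0E; congr (law true _).
  by apply/seteqP; split => x; rewrite /wrong_sign/= leNgt; case: (0 < t x).
congr (law false _).
by apply/seteqP; split => x; rewrite /wrong_sign/=; case: (0 < t x).
Qed.

Let law_right_sign s :
  law s (wrong_sign (~~ s)) = ((1 + tau_feat mu rhop rhom) / 2)%:E.
Proof.
have -> : wrong_sign (~~ s) = ~` wrong_sign s.
  by apply/seteqP; split => x; rewrite /wrong_sign/=; case: s; case: (0 < t x).
rewrite probability_setC; last exact: measurable_wrong_sign.
by rewrite law_wrong_sign -EFinB; congr EFin; field.
Qed.

(** Otherwise [Pp B <= Pm B] for the set [B] where [t] is positive; since [rhop] exceeds [rhom] on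
    [B], this forces [mu B = 0]. Then both laws vanish on [B], whereas their masses there, (1 +
    tau_feat)/2 and (1 - tau_feat)/2, add up to 1. *)
Lemma tau_feat_gt0 : 0 < tau_feat mu rhop rhom.
Proof.
have [_ _ [_ _ PpE] [_ _ PmE] _] := a1.
rewrite ltNge; apply/negP => tau0.
pose B := [set x | 0 < t x].
have BE : wrong_sign false = B.
  by apply/seteqP; split => x; rewrite /wrong_sign/B/=; case: (0 < t x).
have := law_wrong_sign false; have := law_right_sign true; rewrite /= BE => PpB PmB.
have muB : mu B = 0%E.
  have mD : measurable_fun setT (fun x => rhop x - rhom x) by exact: measurable_funB.
  have D0 x : B x -> 0 <= rhop x - rhom x.
    by rewrite /B/= tstat_gt0 subr_ge0 => /ltW.
  have <- : B `&` [set x | rhop x - rhom x != 0] = B.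
    apply: setIidl => x; rewrite /B/= tstat_gt0 => px.
    by rewrite gt_eqF// subr_gt0.
  apply: ge0_integral_eq0_null => //.
  apply/eqP; rewrite eq_le; apply/andP; split; last first.
    by apply: integral_ge0 => x Bx; rewrite lee_fin D0.
  have : (Pp B = Pm B + \int[mu]_(x in B) (rhop x - rhom x)%:E)%E.
    rewrite PpE// PmE// -ge0_integralD//.
    - by apply: eq_integral => x _; rewrite -EFinD addrC subrK.
    - by move=> x _; rewrite lee_fin.
    - exact/measurable_EFinP/measurable_funTS.
    - exact/measurable_EFinP/measurable_funTS.
  rewrite PpB PmB; case: (\int[mu]_(x in B) _)%E => [r| |]//.
  by rewrite -EFinD lee_fin => -[]; lra.
have P0 s : law s B = 0%E.
  have [_ _ ->//] := rho_of_density a1 s.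
  apply: null_set_integral muB => //; apply/measurable_EFinP/measurable_funTS.
  exact: (measurable_rho_of a1).
have := P0 true; have := P0 false; rewrite /= PpB PmB => -[] + []; lra.
Qed.

(** Averaging the error (1 - tau_feat)/2 of an agreeing label and (1 + tau_feat)/2 of a disagreeing
    one: the broadcast shrinks the advantage by gam^k. *)
Lemma mixed_law_wrong_sign gam k (gam0 : 0 < gam) (gam1 : gam < 1) s :
  mixed_law Pp Pm k gam0 gam1 s (wrong_sign s) =
  ((1 - gam ^+ k * tau_feat mu rhop rhom) / 2)%:E.
Proof.
transitivity (((1 + gam ^+ k) / 2)%:E * law s (wrong_sign s) +
  (1 - (1 + gam ^+ k) / 2)%:E * law (~~ s) (wrong_sign s))%E => //.
have := law_right_sign (~~ s); rewrite negbK => ->.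
by rewrite law_wrong_sign -!EFinM -EFinD; congr EFin; field.
Qed.

End feature_error.

(** * Joint law of the root and its children *)

Section joint_law.
Context {R : realType} {n : nat} {d : measure_display} {Omega : measurableType d}.
Context {P : probability Omega R}.
Variables (a b : R) (Pp Pm : probability (n.-tuple R) R).
Variables (K : seq nat -> {RV P >-> nat}) (y : seq nat -> {RV P >-> bool})
          (X : seq nat -> {RV P >-> n.-tuple R}).
Hypotheses (b0 : 0 < b) (ba : b < a).
Hypothesis lim : limit_object a b Pp Pm K y X.

Lemma gamma_gt0 : 0 < gamma a b.
Proof. by rewrite divr_gt0 ?subr_gt0// addr_gt0// (lt_trans b0). Qed.

Lemma gamma_lt1 : gamma a b < 1.
Proof.
have ab0 : 0 < a + b by rewrite addr_gt0// (lt_trans b0).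
by rewrite ltr_pdivrMr// mul1r ltrD2l (lt_trans _ b0)// oppr_lt0.
Qed.

Definition children (js : seq nat) : seq (seq nat) := [seq [:: j] | j <- js].

Definition root_event (s : bool) (S : set nat) : set Omega :=
  [set w | y [::] w = s /\ S (K [::] w)].

Let measurable_y v s : measurable [set w | y v w = s].
Proof.
rewrite (_ : [set w | _] = y v @^-1` [set s])//.
by rewrite -[X in measurable X]setTI; exact: measurable_funP.
Qed.

Let measurable_K v (S : set nat) : measurable (K v @^-1` S).
Proof. by rewrite -[X in measurable X]setTI; exact: measurable_funP. Qed.

Lemma root_eventE s S :
  root_event s S = [set w | y [::] w = s] `&` K [::] @^-1` S.
Proof. by []. Qed.

Lemma measurable_root_event s S : measurable (root_event s S).
Proof. by rewrite root_eventE; exact: measurableI. Qed.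

Lemma measurable_broadcast_bit v : measurable_fun setT (broadcast_bit y v).
Proof.
case: v => [|i u]; first exact: measurable_funP.
apply: (measurable_fun_bool true); rewrite setTI.
rewrite (_ : _ @^-1` _ = ([set w | y (i :: u) w = true] `&` [set w | y u w = true])
   `|` ([set w | y (i :: u) w = false] `&` [set w | y u w = false])).
  by apply: measurableU; apply: measurableI.
apply/seteqP; split => w /=.
  by case: (y (i :: u) w) (y u w) => -[] //= _; [left|right].
by move=> [[-> ->]|[-> ->]].
Qed.

Let bit_law i u (B : set bool) :
  P (broadcast_bit y (i :: u) @^-1` B) = bernoulli_prob ((1 + gamma a b) / 2) B.
Proof.
pose bit : {mfun Omega >-> bool} := HB.pack (broadcast_bit y (i :: u))
  (isMeasurableFun.Build _ _ _ _ _ (measurable_broadcast_bit (i :: u))).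
apply: (@eq_bernoulli R _ (distribution P bit)).
have [_ [_ +] _ _] := lim => /(_ i u) <-.
by congr (P _); apply/seteqP; split => w /= /eqP.
Qed.

Let root_label s : P [set w | y [::] w = s] = (2^-1)%:E.
Proof.
have [_ [h _] _ _] := lim.
case: s => //.
have -> : [set w | y [::] w = false] = ~` [set w | y [::] w = true].
  by apply/seteqP; split => w /=; case: (y [::] w).
rewrite probability_setC// [X in (_ - X)%E]h -EFinB; congr EFin.
by field.
Qed.

Let uniq_children js : uniq js -> uniq (children js).
Proof. by move=> ujs; rewrite map_inj_uniq// => i j []. Qed.

Let root_notin_children js : [::] \notin children js.
Proof. by apply/mapP => -[]. Qed.

(** One instance of the joint independence of child counts and broadcast bits. The list [js] is
    arbitrary because labels live on all words; the tree enters only through the event on [K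
    [::]]. *)
Lemma broadcast_product_law s S js : uniq js ->
  product_law (broadcast_bit y) P
    (fun=> bernoulli_prob ((1 + gamma a b) / 2) : probability bool R)
    (children js) (root_event s S) (2^-1 * fine (P (K [::] @^-1` S))).
Proof.
move=> ujs B mB.
(* Index [inl [::]] carries the event on the number of children, [inr [::]] the root label, and the
   other [inr v] the agreement of [v] with its parent. *)
pose A (j : seq nat + seq nat) := match j with
  | inl v => K v @^-1` S
  | inr [::] => broadcast_bit y [::] @^-1` [set s]
  | inr v => broadcast_bit y v @^-1` B v end.
pose l := [:: inl [::], inr [::] & [seq inr v | v <- children js]] : seq (seq nat + seq nat).
have -> : root_event s S `&` rectangle (broadcast_bit y) (children js) B =
    \bigcap_(j in [set` l]) A j.
  apply/seteqP; split => w.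
    move=> [[ys Sw] rw] j /=; rewrite !inE => /predU1P [->//|/predU1P [->//|]].
    move=> /mapP[v vjs ->]; have /mapP[i _ vE] := vjs.
    by have := rw v vjs; rewrite vE.
  move=> h; split; first split.
  - by apply: (h (inr [::])); rewrite /= !inE eqxx orbT.
  - by apply: (h (inl [::])); rewrite /= !inE eqxx.
  - move=> v /[dup] vjs /mapP[i _ vE]; have := h (inr v); rewrite vE; apply.
    by rewrite /= !inE map_f ?orbT// -vE.
have [_ _ ind _] := lim; apply: (etrans (ind l A _ _)).
- apply/and3P; split.
  + by rewrite inE /=; apply/mapP => -[].
  + by apply/mapP => -[v + [vE]]; rewrite -vE (negPf (root_notin_children js)).
  + have inj : injective (inr : seq nat -> seq nat + seq nat) by move=> ? ? [].
    exact: etrans (map_inj_uniq inj _) (uniq_children ujs).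
- move=> [v|[|i u]] _ /=.
  + by exists S => //; rewrite setTI.
  + by exists [set s] => //; rewrite setTI.
  + by exists (B (i :: u)) => //; rewrite setTI.
rewrite /l !big_cons !big_map /= muleA; congr (_ * _)%E.
  by rewrite EFinM fineK ?fin_num_measure// muleC -(root_label s).
by apply: eq_bigr => i _; exact: bit_law.
Qed.

Local Notation Q s := (fun v : seq nat =>
  mixed_law Pp Pm (size v) gamma_gt0 gamma_lt1 s).

Lemma tree_label_sigma_root_event s S : tree_label_sigma K y (root_event s S).
Proof.
rewrite root_eventE.
apply: (@measurableI _ (g_sigma_algebraType
  (\bigcup_v (sigma_of (K v) `|` sigma_of (y v))))).
  apply: sub_sigma_algebra; exists [::] => //; right.
  by exists [set s] => //; rewrite setTI.
apply: sub_sigma_algebra; exists [::] => //; left.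
by exists S => //; rewrite setTI.
Qed.

(** Given tree and labels the features are independent; a child label is the root label [s]
    corrected by its broadcast bit. Integrating out the independent bits turns each child factor
    into the mixture [mixed_law] of depth 1. *)
Lemma feature_product_law s S js : uniq js ->
  product_law X P (Q s) ([::] :: children js) (root_event s S)
    (2^-1 * fine (P (K [::] @^-1` S))).
Proof.
move=> ujs A mA; have [_ _ _ cf] := lim.
have ucs : uniq ([::] :: children js) by rewrite /= root_notin_children uniq_children.
apply: (etrans (cf _ _ A (tree_label_sigma_root_event s S) ucs mA)).
(* For the agreement bit [c], the label of the child is [c == s]: it is [s] if [c] holds and the
   opposite of [s] otherwise. *)
pose h v c := fine (law_of Pp Pm (c == s) (A v)).
have fin s' v : law_of Pp Pm s' (A v) = (fine (law_of Pp Pm s' (A v)))%:E.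
  by rewrite fineK// fin_num_measure//; exact: mA.
have h0 v c : 0 <= h v c by rewrite fine_ge0.
have mh v : measurable_fun setT (h v) by [].
transitivity (\int[P]_(w in root_event s S) ((fine (law_of Pp Pm s (A [::])))%:E *
    (\prod_(v <- children js) h v (broadcast_bit y v w))%:E))%E.
  apply: eq_integral => w; rewrite inE => -[ys _].
  rewrite big_cons ys -fin; congr (_ * _)%E.
  rewrite -prodEFin /children !big_map; apply: eq_bigr => i _.
  rewrite fin /h /= -ys; congr (fine (law_of _ _ _ _))%:E.
  by case: (y [:: i] w); case: (y [::] w).
rewrite ge0_integralZl_EFin ?fine_ge0//; first last.
- apply/measurable_EFinP/measurable_funTS; apply: measurable_prod => v _.
  exact: measurableT_comp (measurable_broadcast_bit v).
- by move=> w _; rewrite lee_fin prodr_ge0.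
- exact: measurable_root_event.
have pint : 0 <= (1 + gamma a b) / 2 <= 1.
  by have := gamma_gt0; have := gamma_lt1 => *; apply/andP; split; lra.
have inth v : (\int[bernoulli_prob ((1 + gamma a b) / 2)]_c (h v c)%:E =
    ((1 + gamma a b) / 2)%:E * (h v true)%:E +
    (1 - (1 + gamma a b) / 2)%:E * (h v false)%:E)%E.
  by rewrite integral_bernoulli_prob// => c; rewrite lee_fin.
rewrite (integral_product_law measurable_broadcast_bit _ _ _
  (broadcast_product_law s S ujs))//.
- rewrite muleCA big_cons; congr (_ * (_ * _))%E.
    rewrite -fin /= /mixture expr0 divff ?pnatr_eq0// subrr mul0e adde0 mul1e.
    by case: s {cf h h0 mh inth}.
  rewrite /children !big_map; apply: eq_bigr => i _; rewrite inth.
  by rewrite /h -!fin /mixed_law /= /mixture expr1; case: s {cf h h0 mh inth}.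
- exact: uniq_children.
- exact: measurable_root_event.
- by rewrite mulr_ge0// fine_ge0.
- by move=> v _; rewrite inth -!EFinM -EFinD ltry.
Qed.

End joint_law.

(** * Bayes optimality of the score *)

(** Summing over the countably many values of [f]; it reduces comparisons of decisions to a fixed
    number of children. *)
Lemma le_measure_fibers d (T : measurableType d) (R : realType)
    (m : {measure set T -> \bar R}) (f : T -> nat) (A B : set T) :
  measurable_fun setT f -> measurable A -> measurable B ->
  (forall k, m (A `&` [set x | f x = k]) <= m (B `&` [set x | f x = k]))%E ->
  (m A <= m B)%E.
Proof.
move=> mf mA mB AB.
have mk k : measurable [set x | f x = k].
  by rewrite -[X in measurable X]setTI; exact: (mf measurableT [set k]).
have fibers C : measurable C ->
    m C = (\sum_(0 <= k <oo | k \in setT) m (C `&` [set x | f x = k]))%E.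
  move=> mC; rewrite -measure_bigcup.
  - congr (m _); apply/seteqP; split => x.
      by move=> Cx; exists (f x).
    by move=> [k _ []].
  - by move=> k _; exact: measurableI.
  - apply/trivIsetP => i j _ _ /eqP ij; apply/seteqP; split => // x [[_ /= fi] [_ /= fj]].
    by apply: ij; rewrite -fi -fj.
by rewrite (fibers _ mA) (fibers _ mB); apply: lee_nneseries.
Qed.

Section bayes.
Context {R : realType} {n : nat} {d : measure_display} {Omega : measurableType d}.
Context {P : probability Omega R}.
Variables (a b : R) (Pp Pm : probability (n.-tuple R) R).
Variables (K : seq nat -> {RV P >-> nat}) (y : seq nat -> {RV P >-> bool})
          (X : seq nat -> {RV P >-> n.-tuple R}).
Variables (mu : {measure set (n.-tuple R) -> \bar R}) (rhop rhom : n.-tuple R -> R).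
Hypotheses (b0 : 0 < b) (ba : b < a).
Hypothesis lim : limit_object a b Pp Pm K y X.
Hypothesis a1 : assumption1 mu rhop rhom Pp Pm.

Local Notation gam := (gamma a b).
Local Notation M := (Mstat gam rhop rhom).
Local Notation T := (score a b K X rhop rhom).
Local Notation root_event := (root_event K y).

Definition ball1 k : seq (seq nat) := [::] :: children (iota 0 k).

Lemma score0E w : T 0%N w = M 0 (X [::] w).
Proof.
rewrite /score big_nat1 (_ : generation _ 0 = [set [::]]) ?fsbig_set1//.
by apply/seteqP; split => v /=; [move=> [_ /size0nil]|move=> ->].
Qed.

Lemma score1E w :
  T 1%N w = \sum_(v <- ball1 (K [::] w)) M (size v) (X v w).
Proof.
rewrite -[LHS]/(\sum_(0 <= k < 2) _) big_nat_recl// big_nat1.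
rewrite /ball1 big_cons; congr (_ + _); first by rewrite -score0E /score big_nat1.
have uc : uniq (children (iota 0 (K [::] w))).
  by rewrite map_inj_uniq ?iota_uniq// => i j [].
rewrite (_ : generation _ 1 = [set` children (iota 0 (K [::] w))]).
  rewrite -fsbig_seq// /children !big_map.
  by apply: eq_bigr.
apply/seteqP; split => v /=.
  move=> [+ v1]; case: v v1 => [//|i [|//]] _ /= iK.
  by apply/mapP; exists i => //; rewrite mem_iota.
by move=> /mapP[i + ->] /=; rewrite mem_iota.
Qed.

(* The decisions that may use the features up to depth 1, the root having k
   children. *)
Definition observable k (B : set Omega) := <<s rectangles X (ball1 k) >> B.

Let ball1_uniq k : uniq (ball1 k).
Proof.
rewrite /ball1 cons_uniq; apply/andP; split; first by apply/mapP => -[].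
by rewrite /children map_inj_uniq ?iota_uniq// => i j [].
Qed.

Let mX v : measurable_fun setT (X v). Proof. exact: measurable_funP. Qed.

Lemma observable_measurable k B : observable k B -> measurable B.
Proof.
apply: smallest_sub; first exact: sigma_algebra_measurable.
by move=> _ [A mA <-]; exact: measurable_rectangle.
Qed.

Lemma observable_preimage k v A :
  v \in ball1 k -> measurable A -> observable k (X v @^-1` A).
Proof. exact: measurable_rectangles. Qed.

Lemma observableI k A B : observable k A -> observable k B -> observable k (A `&` B).
Proof. exact: (@measurableI _ (g_sigma_algebraType (rectangles X (ball1 k)))). Qed.

Lemma observableU k A B : observable k A -> observable k B -> observable k (A `|` B).
Proof. exact: (@measurableU _ (g_sigma_algebraType (rectangles X (ball1 k)))). Qed.

Lemma observableC k A : observable k A -> observable k (~` A).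
Proof. exact: (@measurableC _ (g_sigma_algebraType (rectangles X (ball1 k)))). Qed.

Definition score_ball k w : R := \sum_(v <- ball1 k) M (size v) (X v w).

Lemma observable_score_ball k : observable k [set w | 0 < score_ball k w].
Proof.
(* Replacing the terms outside the ball by 0 makes every term, not only those that are summed,
   measurable for the observable sigma-algebra. *)
pose F v : Omega -> R :=
  if v \in ball1 k then fun w => M (size v) (X v w) else fun=> 0.
have mF v : measurable_fun setT
    (F v : g_sigma_algebraType (rectangles X (ball1 k)) -> R).
  rewrite /F; case: ifP => vk; last exact: measurable_cst.
  move=> _ B mB; rewrite setTI.
  apply: (observable_preimage vk (A := M (size v) @^-1` B)).
  rewrite -[X in measurable X]setTI; exact: (measurable_Mstat a1).
have mS : measurable_fun setT ((fun w => \sum_(v <- ball1 k) F v w) :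
    g_sigma_algebraType (rectangles X (ball1 k)) -> R).
  exact: measurable_sum.
have E w : score_ball k w = \sum_(v <- ball1 k) F v w.
  by rewrite /score_ball !big_seq; apply: eq_bigr => v vk; rewrite /F vk.
have -> : [set w | 0 < score_ball k w] =
   setT `&` (fun w => \sum_(v <- ball1 k) F v w) @^-1` `]0, +oo[%classic.
  by rewrite setTI; apply/seteqP; split => w /=; rewrite in_itv/= andbT E.
exact: mS.
Qed.

Let c S : R := 2^-1 * fine (P (K [::] @^-1` S)).

Let c_ge0 S : 0 <= c S. Proof. by rewrite mulr_ge0// fine_ge0. Qed.

(** Each feature of depth at most 1 contributes the density [expR (M (size v) x)], and the number of
    children contributes nothing, as both root events have the same mass. So [score_ball] is the
    log-likelihood ratio of the observed data. *)
Lemma root_event_tilt k B : observable k B ->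
  (P (root_event true [set k] `&` B) =
   \int[P]_(w in root_event false [set k] `&` B) (expR (score_ball k w))%:E)%E.
Proof.
move=> oB.
have /= -> := product_law_density mX (ball1_uniq k)
  (measurable_root_event K y true [set k]) (measurable_root_event K y false [set k])
  (c_ge0 [set k])
  (feature_product_law b0 ba lim true [set k] (iota_uniq 0 k))
  (feature_product_law b0 ba lim false [set k] (iota_uniq 0 k))
  (f := fun v x => expR (M (size v) x)) _ _ _ oB.
- by apply: eq_integral => w _; rewrite /score_ball expR_sum.
- move=> v; apply: measurableT_comp => //; exact: (measurable_Mstat a1).
- by move=> v x; exact: expR_ge0.
- by move=> v A mA; exact: (mixed_law_tilt a1).
Qed.

Let mroot s S : measurable (root_event s S).
Proof. exact: measurable_root_event. Qed.

Let mexp k B : measurable B ->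
  measurable_fun (root_event false [set k] `&` B) (fun w => (expR (score_ball k w))%:E).
Proof.
move=> mB; apply/measurable_EFinP/measurable_funTS; apply: measurableT_comp => //.
apply: measurable_sum => v; apply: measurableT_comp => //; exact: (measurable_Mstat a1).
Qed.

(** The density of [root_event_tilt] is at least 1 on [B]. *)
Lemma root_event_pos k B : observable k B -> B `<=` [set w | 0 < score_ball k w] ->
  (P (root_event false [set k] `&` B) <= P (root_event true [set k] `&` B))%E.
Proof.
move=> oB Bpos; have mB := observable_measurable oB.
rewrite root_event_tilt// -[leLHS]mul1e -integral_cst; last exact: measurableI.
apply: ge0_le_integral => //.
- exact: measurableI.
- exact: mexp.
- by move=> w [_ Bw]; rewrite lee_fin -expR0 ler_expR ltW//; exact: Bpos.
Qed.

Lemma root_event_neg k B : observable k B -> B `<=` ~` [set w | 0 < score_ball k w] ->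
  (P (root_event true [set k] `&` B) <= P (root_event false [set k] `&` B))%E.
Proof.
move=> oB Bneg; have mB := observable_measurable oB.
rewrite root_event_tilt// -[leRHS]mul1e -integral_cst; last exact: measurableI.
apply: ge0_le_integral => //.
- exact: measurableI.
- exact: mexp.
- move=> w [_ Bw]; rewrite lee_fin -expR0 ler_expR leNgt.
  by apply/negP; exact: Bneg.
Qed.

Definition misclassified (h : Omega -> bool) : set Omega :=
  [set w | y [::] w != h w].

Lemma misclassifiedE (h : Omega -> bool) S A :
  measurable [set w | h w] -> measurable A ->
  P (misclassified h `&` (K [::] @^-1` S `&` A)) =
  (P (root_event true S `&` (A `&` ~` [set w | h w])) +
   P (root_event false S `&` (A `&` [set w | h w])))%E.
Proof.
move=> mh mA; rewrite -measureU.
- congr (P _); apply/seteqP; split => w; rewrite /misclassified/root_event/=.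
    by move=> [+ [Kw Aw]]; case: (y [::] w) (h w) => -[]// _; [left|right].
  by move=> [[[-> Kw] [Aw /negP]]|[[-> Kw] [Aw]]]; case: (h w).
- by apply: measurableI => //; apply: measurableI => //; exact: measurableC.
- by apply: measurableI => //; exact: measurableI.
- apply/seteqP; split => // w [[[/= yt _] _] [[/= yf _] _]].
  by rewrite yt in yf.
Qed.

Lemma measurable_misclassified (h : Omega -> bool) : measurable [set w | h w] ->
  measurable (misclassified h).
Proof.
move=> mh; have my s : measurable [set w | y [::] w = s].
  rewrite (_ : [set w | _] = y [::] @^-1` [set s])//.
  by rewrite -[X in measurable X]setTI; exact: measurable_funP.
have -> : misclassified h = ([set w | y [::] w = true] `&` ~` [set w | h w]) `|`
    ([set w | y [::] w = false] `&` [set w | h w]).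
  apply/seteqP; split => w; rewrite /misclassified/=.
    by case: (y [::] w) (h w) => -[]// _; [left|right].
  by move=> [[-> /negP]|[->]]; case: (h w).
by apply: measurableU; apply: measurableI => //; exact: measurableC.
Qed.

(** The Neyman-Pearson exchange: the two decisions differ only on [V] minus [H] and on [H] minus
    [V], and on each of these [V] answers the label that has the larger mass. *)
Lemma bayes_fiber k (V H : set Omega) :
  V = [set w | 0 < score_ball k w] -> observable k H ->
  (P (root_event true [set k] `&` ~` V) + P (root_event false [set k] `&` V) <=
   P (root_event true [set k] `&` ~` H) + P (root_event false [set k] `&` H))%E.
Proof.
move=> VE oH; have oV : observable k V by rewrite VE; exact: observable_score_ball.
have [mV mH] := (observable_measurable oV, observable_measurable oH).
have split_by A B : measurable A -> measurable B ->
    P A = (P (A `&` B) + P (A `&` ~` B))%E.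
  by move=> mA mB; rewrite (measureDI P mA mB) addeC setDE.
have mD s A : measurable A -> measurable (root_event s [set k] `&` A).
  exact: measurableI.
have pos : (P (root_event false [set k] `&` V `&` ~` H) <=
            P (root_event true [set k] `&` ~` H `&` V))%E.
  rewrite -!(setIA (root_event _ _)) [~` H `&` V]setIC; apply: root_event_pos.
    by apply: observableI => //; exact: observableC.
  by rewrite VE => w [].
have neg : (P (root_event true [set k] `&` ~` V `&` H) <=
            P (root_event false [set k] `&` H `&` ~` V))%E.
  rewrite -!(setIA (root_event _ _)) [H `&` ~` V]setIC; apply: root_event_neg.
    by apply: observableI => //; exact: observableC.
  by rewrite VE => w [].
(* Each of the four error events is cut by the other decision; the pieces where the decisions agree
   match, and [pos] and [neg] compare the rest. *)
rewrite (split_by _ H (mD true _ (measurableC mV)) mH).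
rewrite (split_by _ H (mD false _ mV) mH).
rewrite (split_by _ V (mD true _ (measurableC mH)) mV).
rewrite (split_by _ V (mD false _ mH) mV).
rewrite [X in (X + _ <= _)%E]addeC addeACA [X in (_ <= X + _)%E]addeC [leRHS]addeACA.
rewrite [X in (_ <= _ + X)%E]addeC; apply: leeD; last exact: leeD.
by rewrite -!(setIA (root_event _ _)) [~` V `&` _]setIC [V `&` _]setIC.
Qed.

Lemma measurable_decision (h : nat -> Omega -> bool) :
  (forall k, observable k [set w | h k w]) -> measurable [set w | h (K [::] w) w].
Proof.
move=> oh; have -> : [set w | h (K [::] w) w] =
    \bigcup_k (K [::] @^-1` [set k] `&` [set w | h k w]).
  apply/seteqP; split => w /=; first by move=> hw; exists (K [::] w).
  by move=> [k _ [/= <-]].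
apply: bigcupT_measurable => k.
apply: measurableI; last exact: observable_measurable (oh k).
by rewrite -[X in measurable X]setTI; exact: measurable_funP.
Qed.

(** The decision may depend on the number of children, so the comparison is made by [bayes_fiber] on
    each event that fixes it. *)
Lemma bayes_optimal (h : nat -> Omega -> bool) :
  (forall k, observable k [set w | h k w]) ->
  (P (misclassified (fun w => 0 < T 1%N w)%R) <=
   P (misclassified (fun w => h (K [::] w) w)))%E.
Proof.
move=> oh.
have mis (g : nat -> Omega -> bool) (og : forall k, observable k [set w | g k w]) k :
    (P (misclassified (fun w => g (K [::] w) w) `&` [set w | K [::] w = k]) =
    P (root_event true [set k] `&` ~` [set w | g k w]) +
    P (root_event false [set k] `&` [set w | g k w]))%E.
  rewrite -[X in (P (_ `&` X) + _)%E]setTI -[X in (_ + P (_ `&` X))%E]setTI.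
  rewrite -(misclassifiedE _ (observable_measurable (og k)))// setIT.
  by congr (P _); apply/seteqP; split => w /= [+ wk]; rewrite /misclassified/= wk.
have score_fib w : (0 < T 1%N w) = (0 < score_ball (K [::] w) w).
  by rewrite score1E.
under eq_fun do rewrite score_fib.
have oT k : observable k [set w | 0 < score_ball k w] by exact: observable_score_ball.
apply: (@le_measure_fibers _ _ _ P (K [::])); first exact: measurable_funP.
- by apply: measurable_misclassified; apply: (measurable_decision (h := fun k w => 0 < score_ball k w)).
- by apply: measurable_misclassified; exact: measurable_decision.
move=> k; have /= -> := mis (fun k w => 0 < score_ball k w) oT k; rewrite mis//.
exact: bayes_fiber.
Qed.

End bayes.

(** * Comparison of the errors *)

Section error_gap.
Context {R : realType} {n : nat} {d : measure_display} {Omega : measurableType d}.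
Context {P : probability Omega R}.
Variables (a b : R) (Pp Pm : probability (n.-tuple R) R).
Variables (K : seq nat -> {RV P >-> nat}) (y : seq nat -> {RV P >-> bool})
          (X : seq nat -> {RV P >-> n.-tuple R}).
Variables (mu : {measure set (n.-tuple R) -> \bar R}) (rhop rhom : n.-tuple R -> R).
Hypotheses (b0 : 0 < b) (ba : b < a).
Hypothesis lim : limit_object a b Pp Pm K y X.
Hypothesis a1 : assumption1 mu rhop rhom Pp Pm.

Local Notation gam := (gamma a b).
Local Notation M := (Mstat gam rhop rhom).
Local Notation T := (score a b K X rhop rhom).
Local Notation t := (tstat rhop rhom).
Local Notation law := (law_of Pp Pm).
Local Notation root_event := (root_event K y).
Local Notation misclassified := (misclassified y).

Hypothesis tie0 : P [set w | T 0%N w = 0] = 0%E.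
Hypothesis tie1 : P [set w | T 1%N w = 0] = 0%E.

Let mroot s S : measurable (root_event s S).
Proof. exact: measurable_root_event. Qed.

Let measurable_X v A : measurable A -> measurable (X v @^-1` A).
Proof. by move=> mA; rewrite -[X in measurable X]setTI; exact: measurable_funP. Qed.

Let measurable_K (S : set nat) : measurable (K [::] @^-1` S).
Proof. by rewrite -[X in measurable X]setTI; exact: measurable_funP. Qed.

Lemma mixed_law0 (gam0 : 0 < gam) (gam1 : gam < 1) s A :
  mixed_law Pp Pm 0 gam0 gam1 s A = law s A.
Proof.
by rewrite /mixed_law /= /mixture expr0 divff ?pnatr_eq0// subrr mul0e adde0 mul1e.
Qed.

Lemma root_feature_law s S A : measurable A ->
  P (root_event s S `&` X [::] @^-1` A) =
  ((2^-1 * fine (P (K [::] @^-1` S)))%:E * law s A)%E.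
Proof.
move=> mA; have := feature_product_law b0 ba lim s S (isT : uniq [::]) (fun=> mA).
rewrite big_seq1 => h.
rewrite -(mixed_law0 (gamma_gt0 b0 ba) (gamma_lt1 b0 ba)) -[RHS]h.
by congr (P (_ `&` _)); apply/seteqP; split => w /=;
  [move=> wA v; rewrite /= inE => /eqP ->|apply; rewrite /= mem_head].
Qed.

Lemma root_child_feature_law s S A B : measurable A -> measurable B ->
  P (root_event s S `&` (X [::] @^-1` A `&` X [:: 0%N] @^-1` B)) =
  ((2^-1 * fine (P (K [::] @^-1` S)))%:E *
   (law s A * mixed_law Pp Pm 1 (gamma_gt0 b0 ba) (gamma_lt1 b0 ba) s B))%E.
Proof.
move=> mA mB; pose F (v : seq nat) := if v is [::] then A else B.
have mF v : measurable (F v) by case: v.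
have := feature_product_law b0 ba lim s S (isT : uniq [:: 0%N]) mF.
rewrite /children /= big_cons big_seq1 => h.
rewrite -(mixed_law0 (gamma_gt0 b0 ba) (gamma_lt1 b0 ba)) -[RHS]h.
congr (P (_ `&` _)); apply/seteqP; split => w /=.
  by move=> [wA wB] v; rewrite /= !inE => /orP[/eqP ->|/eqP ->].
by move=> h'; split; [apply: (h' [::])|apply: (h' [:: 0%N])]; rewrite /= !inE eqxx ?orbT.
Qed.

(** The range of summation of [T 1] is random, so preimages are cut along the countably many values
    of [K [::]]. *)
Lemma measurable_score l : (l <= 1)%N -> measurable_fun setT (T l).
Proof.
case: l => [_|[_|//]].
  rewrite (_ : T 0%N = (fun w => M 0 (X [::] w))).
    by apply: measurableT_comp => //; exact: (measurable_Mstat a1).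
  by apply/funext => w; exact: score0E.
move=> _ B mB; rewrite setTI.
have -> : T 1%N @^-1` B = \bigcup_k (K [::] @^-1` [set k] `&`
    (score_ball a b X rhop rhom k) @^-1` B).
  apply/seteqP; split => w /=; rewrite score1E.
    by move=> Bw; exists (K [::] w).
  by move=> [k _ [/= ->]].
apply: bigcupT_measurable => k; apply: measurableI => //.
rewrite -[X in measurable X]setTI.
have mS : measurable_fun setT (score_ball a b X rhop rhom k).
  by apply: measurable_sum => v; apply: measurableT_comp => //; exact: (measurable_Mstat a1).
exact: mS.
Qed.

Let measurable_score_gt0 l : (l <= 1)%N -> measurable [set w | 0 < T l w].
Proof. by move=> l1; apply: measurable_fun_gt0; exact: measurable_score. Qed.

(** [error] counts a tie as wrong for both labels, [misclassified] only for the label [true]; the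
    difference lies in the null tie event. *)
Lemma errorE l : (l <= 1)%N ->
  error a b K y X rhop rhom l = fine (P (misclassified (fun w => 0 < T l w))).
Proof.
move=> l1; rewrite /error; congr fine.
have tie : P [set w | T l w = 0] = 0%E by case: l l1 => [|[]].
have mtie : measurable [set w | T l w = 0].
  by apply: measurable_fun_eq; exact: measurable_score.
have -> : [set w | sign (y [::] w) * T l w <= 0] =
    misclassified (fun w => 0 < T l w) `|`
    (root_event false setT `&` [set w | T l w = 0]).
  apply/seteqP; split => w; rewrite /misclassified/root_event/=.
    case: (y [::] w); rewrite /sign ?mul1r ?mulN1r ?oppr_le0.
      by rewrite leNgt => /negP; case: (0 < T l w) => // _; left.
    by rewrite le_eqVlt => /orP[/eqP <-|->]; [right|left].
  case: (y [::] w); rewrite /sign ?mul1r ?mulN1r ?oppr_le0.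
    by rewrite leNgt => -[|[[]]//]; case: (0 < T l w).
  by move=> [|[_ ->//]]; case: ltP => // /ltW.
apply: measureU0.
- apply: measurable_misclassified; exact: measurable_score_gt0.
- exact: measurableI.
- by apply: (subset_measure0 _ mtie _ tie); [exact: measurableI|move=> w []].
Qed.

(** A zero of [t] at the root makes [T 0] vanish, and each root label has positive probability, so
    the null tie event makes these zeros null under either law. *)
Lemma tie_features s : law s [set x | t x = 0] = 0%E.
Proof.
have mE : measurable [set x | t x = 0].
  by apply: measurable_fun_eq; exact: (measurable_tstat a1).
have : P (root_event s setT `&` X [::] @^-1` [set x | t x = 0]) = 0%E.
  apply: (subset_measure0 _ _ _ tie0).
  - by apply: measurableI => //; exact: measurable_X.
  - by apply: measurable_fun_eq; exact: measurable_score.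
  move=> w [_ /= tw]; rewrite score0E /Mstat /artanh tw.
  by rewrite mulr0 addr0 subr0 divr1 ln1 mul0r mulr0.
rewrite root_feature_law// preimage_setT probability_setT /= mulr1 => /eqP.
by rewrite mule_eq0 eqe invr_eq0 pnatr_eq0 /= => /eqP.
Qed.

(** The sign of [T 0] reads the root feature only, hence is among the competitors in
    [bayes_optimal]. *)
Lemma error_mono : error a b K y X rhop rhom 1 <= error a b K y X rhop rhom 0.
Proof.
rewrite !errorE//; apply: fine_le.
- by apply: fin_num_measure; apply: measurable_misclassified; exact: measurable_score_gt0.
- by apply: fin_num_measure; apply: measurable_misclassified; exact: measurable_score_gt0.
apply: (bayes_optimal b0 ba lim a1 (h := fun=> fun w => 0 < T 0%N w)) => k.
rewrite (_ : [set w | _] = X [::] @^-1` [set x | 0 < M 0 x]).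
  apply: observable_preimage; first exact: mem_head.
  by apply: measurable_fun_gt0; exact: (measurable_Mstat a1).
by apply/seteqP; split => w /=; rewrite score0E.
Qed.

Definition near0_set (delta : R) : set (n.-tuple R) :=
  [set x | `|ln (psi rhop rhom x)| <= ln ((1 + delta) / (1 - delta))].

Lemma measurable_near0_set delta : measurable (near0_set delta).
Proof.
pose f x := `|ln (psi rhop rhom x)| - ln ((1 + delta) / (1 - delta)).
rewrite (_ : near0_set delta = ~` [set x | 0 < f x]).
  apply: measurableC; apply: measurable_fun_gt0; apply: measurable_funB => //.
  do 2 (apply: measurableT_comp => //); by apply: measurable_psi; [exact: (measurable_rho_of a1 true)|exact: (measurable_rho_of a1 false)].
apply/seteqP; split => x; rewrite /near0_set/f/= subr_gt0 leNgt; last by move/negP.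
by move=> /negP.
Qed.

Let prob_root_child : R := fine (P (K [::] @^-1` [set k | (0 < k)%N])).

(* When log psi at the root is near 0, the root has a child and its first child
   is trusted instead of the root. *)
Let first_child (delta : R) (k : nat) (w : Omega) : bool :=
  if (0 < k)%N && (`|ln (psi rhop rhom (X [::] w))| <= ln ((1 + delta) / (1 - delta)))
  then 0 < t (X [:: 0%N] w) else 0 < M 0 (X [::] w).

Let observable_first_child delta k : observable X k [set w | first_child delta k w].
Proof.
have oroot A : measurable A -> observable X k (X [::] @^-1` A).
  by move=> mA; apply: observable_preimage => //; exact: mem_head.
have mM := measurable_fun_gt0 (measurable_Mstat a1 gam 0).
have mt := measurable_fun_gt0 (measurable_tstat a1).
have mW := measurable_near0_set delta.
case: k oroot => [|k] oroot; first exact: (oroot _ mM).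
have -> : [set w | first_child delta k.+1 w] =
    (X [::] @^-1` near0_set delta `&` X [:: 0%N] @^-1` [set x | 0 < t x]) `|`
    (X [::] @^-1` (~` near0_set delta) `&` X [::] @^-1` [set x | 0 < M 0 x]).
  apply/seteqP; split => w; rewrite /first_child/near0_set/=.
    by case: ifPn => [wW tw|/negP wW Mw]; [left|right].
  by move=> [[-> //]|[/negP/negPf -> //]].
apply: observableU; apply: observableI.
- exact: oroot.
- by apply: observable_preimage => //; rewrite /ball1/children/= !inE eqxx orbT.
- by apply: oroot; exact: measurableC.
- exact: oroot.
Qed.

Let fineE (Q : probability (n.-tuple R) R) A : measurable A -> Q A = (fine (Q A))%:E.
Proof. by move=> mA; rewrite fineK// fin_num_measure. Qed.

(** By [bayes_optimal], the gap is at least that between the root rule [h0] and the competitor [h].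
    They coincide off [C]; on [C] their errors have rates at least (1 - delta)/2 and exactly (1 -
    gam tau_feat)/2. *)
Lemma error_gap_child delta : 0 < delta -> delta < 1 ->
  prob_root_child * (gam * tau_feat mu rhop rhom - delta) / 2 *
    fine (balanced Pp Pm (near0_set delta)) <=
  error a b K y X rhop rhom 0 - error a b K y X rhop rhom 1.
Proof.
move=> d0 d1; have mW := measurable_near0_set delta; set W := near0_set delta in mW *.
set S := [set k | (0 < k)%N].
pose C := K [::] @^-1` S `&` X [::] @^-1` W.
have mC : measurable C by apply: measurableI => //; exact: measurable_X.
pose h := fun w => first_child delta (K [::] w) w.
pose h0 := fun w => 0 < T 0%N w.
have mM := measurable_fun_gt0 (measurable_Mstat a1 gam 0).
have mt := measurable_fun_gt0 (measurable_tstat a1).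
have mh0 : measurable [set w | h0 w] by exact: measurable_score_gt0.
have mh : measurable [set w | h w].
  exact: (measurable_decision K (observable_first_child delta)).
have [mmh mmh0] := (measurable_misclassified y mh, measurable_misclassified y mh0).
have off_C : misclassified h0 `\` C = misclassified h `\` C.
  apply/seteqP; split => w [+ nC]; rewrite /misclassified/h0/h/first_child/= score0E;
  by case: ifPn => // /andP[Kw Ww] _; exfalso; apply: nC.
have bal_fine : fine (balanced Pp Pm W) = 2^-1 * (fine (Pp W) + fine (Pm W)).
  by rewrite /balanced (fineE Pp)// (fineE Pm)// -EFinD -EFinM.
have wrongE : (P (misclassified h `&` C) =
    (prob_root_child * ((1 - gam * tau_feat mu rhop rhom) / 2) *
     fine (balanced Pp Pm W))%:E)%E.
  have -> : misclassified h `&` C = misclassified (fun w => 0 < t (X [:: 0%N] w)) `&` C.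
    apply/seteqP; split => w [+ [Kw Ww]]; rewrite /misclassified/h/first_child/=;
    by rewrite ifT//; exact/andP.
  rewrite misclassifiedE//; last exact: measurable_X.
    have -> : ~` [set w | 0 < t (X [:: 0%N] w)] = X [:: 0%N] @^-1` wrong_sign rhop rhom true.
      by apply/seteqP; split => w; rewrite /wrong_sign/=; case: (0 < _).
    have -> : [set w | 0 < t (X [:: 0%N] w)] = X [:: 0%N] @^-1` wrong_sign rhop rhom false.
      by apply/seteqP; split => w; rewrite /wrong_sign/=; case: (0 < _).
    rewrite !root_child_feature_law//; try exact: (measurable_wrong_sign a1).
    rewrite !(mixed_law_wrong_sign a1 tie_features) expr1 /= -/S.
    rewrite (fineE Pp)// (fineE Pm)// -/prob_root_child bal_fine -!EFinM -EFinD.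
    by congr EFin; field.
  exact: (measurable_X [:: 0%N] mt).
have rootE : ((prob_root_child * ((1 - delta) / 2) * fine (balanced Pp Pm W))%:E <=
    P (misclassified h0 `&` C))%E.
  rewrite misclassifiedE//; last exact: measurable_X.
  have -> : X [::] @^-1` W `&` ~` [set w | h0 w] =
      X [::] @^-1` (W `\` [set x | 0 < M 0 x]).
    by apply/seteqP; split => w; rewrite /h0/= score0E.
  have -> : X [::] @^-1` W `&` [set w | h0 w] =
      X [::] @^-1` (W `&` [set x | 0 < M 0 x]).
    by apply/seteqP; split => w; rewrite /h0/= score0E.
  have mA1 : measurable (W `\` [set x | 0 < M 0 x]) by exact: measurableD.
  have mA2 : measurable (W `&` [set x | 0 < M 0 x]) by exact: measurableI.
  rewrite !root_feature_law// -/S.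
  (* On either part of [W] the root rule errs under the label it does not answer: [true] where [M 0]
     is not positive, [false] where it is. Each of these laws keeps at least 1 - delta of the
     balanced mass of its part. *)
  have := balanced_near0_le a1 true d0 d1 mA1 (@subDsetl _ _ _).
  have := balanced_near0_le a1 false d0 d1 mA2 (@subIsetl _ _ _).
  have split_W (Q : probability (n.-tuple R) R) : fine (Q W) =
      fine (Q (W `\` [set x | 0 < M 0 x])) + fine (Q (W `&` [set x | 0 < M 0 x])).
    by rewrite -fineD ?fin_num_measure// -measureDI.
  rewrite bal_fine (split_W Pp) (split_W Pm) /balanced /=.
  rewrite (fineE Pp mA1) (fineE Pp mA2) (fineE Pm mA1) (fineE Pm mA2).
  do ![rewrite -EFinD|rewrite -EFinM]; rewrite !lee_fin /= -/prob_root_child.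
  have := fine_ge0 (measure_ge0 P (K [::] @^-1` S)); rewrite -/prob_root_child.
  move: prob_root_child (fine (Pp _)) (fine (Pp _)) (fine (Pm _)) (fine (Pm _)).
  move=> q u1 u2 v1 v2 q0 h1 h2.
  have := ler_wpM2l q0 h1; have := ler_wpM2l q0 h2; lra.
have split_C A : measurable A ->
    fine (P A) = fine (P (A `\` C)) + fine (P (A `&` C)).
  move=> mA; rewrite -fineD ?fin_num_measure -?measureDI//.
  - exact: measurableD.
  - exact: measurableI.
have : fine (P (misclassified (fun w => 0 < T 1%N w))) <= fine (P (misclassified h)).
  have m1 : measurable (misclassified (fun w => 0 < T 1%N w)).
    by apply: measurable_misclassified; exact: measurable_score_gt0.
  apply: fine_le; rewrite ?fin_num_measure//.
  exact: (bayes_optimal b0 ba lim a1 (observable_first_child delta)).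
move: rootE; rewrite -(@fineK _ (P (_ `&` C))) ?lee_fin; last first.
  by apply: fin_num_measure; exact: measurableI.
rewrite !errorE// (split_C _ mmh) (split_C _ mmh0) off_C wrongE /=.
lra.
Qed.

End error_gap.

(** * The constants of the bound and the strict inequality *)

Section main_bound.
Context {R : realType} {n : nat} {d : measure_display} {Omega : measurableType d}.
Context {P : probability Omega R}.
Variables (a b : R) (Pp Pm : probability (n.-tuple R) R).
Variables (K : seq nat -> {RV P >-> nat}) (y : seq nat -> {RV P >-> bool})
          (X : seq nat -> {RV P >-> n.-tuple R}).
Variables (mu : {measure set (n.-tuple R) -> \bar R}) (rhop rhom : n.-tuple R -> R).
Hypotheses (b0 : 0 < b) (ba : b < a).
Hypothesis lim : limit_object a b Pp Pm K y X.
Hypothesis a1 : assumption1 mu rhop rhom Pp Pm.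
Hypothesis tie0 : P [set w | score a b K X rhop rhom 0 w = 0] = 0%E.
Hypothesis tie1 : P [set w | score a b K X rhop rhom 1 w = 0] = 0%E.

Local Notation t1 := (tau1 a b (tau_feat mu rhop rhom)).
Local Notation E := (error a b K y X rhop rhom).

Let Delta_gt0 : 0 < Delta a b.
Proof. by rewrite divr_gt0// addr_gt0// (lt_trans b0). Qed.

Lemma prob_root_childE :
  fine (P (K [::] @^-1` [set k | (0 < k)%N])) = 1 - expR (- Delta a b).
Proof.
have [/(_ [::] 0%N) + _ _ _] := lim.
rewrite /poisson_pmf Delta_gt0 expr0 fact0 invr1 mulr1 mul1r => P0.
have -> : K [::] @^-1` [set k | (0 < k)%N] = ~` [set w | K [::] w = 0%N].
  by apply/seteqP; split => w /=; rewrite lt0n => /eqP.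
rewrite probability_setC; first by rewrite [X in (_ - X)%E]P0.
rewrite (_ : [set w | _] = K [::] @^-1` [set 0%N])//.
by rewrite -[X in measurable X]setTI; exact: measurable_funP.
Qed.

Let tau_gt0 : 0 < tau_feat mu rhop rhom.
Proof. exact: (tau_feat_gt0 a1 (tie_features b0 ba lim a1 tie0)). Qed.

Let tau_le1 : tau_feat mu rhop rhom <= 1.
Proof.
have : (0 <= law_of Pp Pm true (wrong_sign rhop rhom true))%E by [].
rewrite (law_wrong_sign a1 (tie_features b0 ba lim a1 tie0)) lee_fin.
by rewrite pmulr_lge0 ?invr_gt0// subr_ge0.
Qed.

Let child_gt0 : 0 < 1 - expR (- Delta a b).
Proof. by rewrite subr_gt0 expR_lt1 oppr_lt0. Qed.

Let child_le1 : 1 - expR (- Delta a b) <= 1.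
Proof. by rewrite gerBl expR_ge0. Qed.

Lemma tau1_gt0 : 0 < t1.
Proof. by apply: mulr_gt0 => //; apply: mulr_gt0 => //; exact: gamma_gt0. Qed.

Lemma tau1_le1 : t1 <= 1.
Proof.
have g0 := gamma_gt0 b0 ba; have g1 := gamma_lt1 b0 ba.
apply: mulr_ile1 => //; [exact: mulr_ge0 (ltW _) (ltW _)|exact: ltW|].
by apply: mulr_ile1 => //; exact: ltW.
Qed.

(** With q the probability that the root has a child, [error_gap_child] has constant q (gam tau_feat
    - delta)/2 = t1/2 - q delta/2, which is at least t1/2 - delta since q <= 1. *)
Lemma error_gap delta : 0 < delta -> delta < t1 / 2 ->
  (t1 / 2 - delta) * fine (balanced Pp Pm (near0_set rhop rhom delta)) <= E 0%N - E 1%N.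
Proof.
move=> d0 dt; have d1 : delta < 1 by have := tau1_le1; lra.
apply: le_trans (error_gap_child b0 ba lim a1 tie0 tie1 d0 d1).
rewrite prob_root_childE; apply: ler_wpM2r.
  by apply: fine_ge0; rewrite /balanced mule_ge0// ?lee_fin// adde_ge0.
have := ler_wpM2r (ltW d0) child_le1; rewrite /tau1; lra.
Qed.

Lemma error_lt : positive_mass_near0 rhop rhom Pp Pm -> E 1%N < E 0%N.
Proof.
move=> pos; have t0 := tau1_gt0; have t1' := tau1_le1.
(* An admissible value that leaves the positive factor [t1 / 2 - delta]; the ball of radius [L]
   around 0 is then a neighbourhood whose preimage lies in [near0_set]. *)
pose delta := t1 / 4.
have d0 : 0 < delta by rewrite divr_gt0.
have dt : delta < t1 / 2 by rewrite /delta; lra.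
pose L := ln ((1 + delta) / (1 - delta)).
have L0 : 0 < L.
  have d1 : 0 < 1 - delta by rewrite /delta; lra.
  by rewrite ln_gt0// ltr_pdivlMr// mul1r; lra.
have pos0 : (0 < balanced Pp Pm (near0_set rhop rhom delta))%E.
  have mW := measurable_near0_set a1 delta.
  pose U : set R := ball 0 L.
  have posL : (0 < balanced Pp Pm [set x | U (ln (psi rhop rhom x))])%E.
    by apply: pos; [exact: ball_open|exact: ballxx].
  have UE : [set x | U (ln (psi rhop rhom x))] =
      [set x | 0 < L - `|ln (psi rhop rhom x)|].
    by apply/seteqP; split => x; rewrite /U/ball/= sub0r normrN subr_gt0.
  move: posL; rewrite UE => posL; apply: (lt_le_trans posL).
  rewrite /balanced; apply: lee_wpmul2l; first by rewrite lee_fin.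
  have sub : [set x | 0 < L - `|ln (psi rhop rhom x)|] `<=` near0_set rhop rhom delta.
    by move=> x /=; rewrite subr_gt0 => /ltW.
  have mU : measurable [set x | 0 < L - `|ln (psi rhop rhom x)|].
    apply: measurable_fun_gt0; apply: measurable_funB => //.
    do 2 (apply: measurableT_comp => //); apply: measurable_psi.
      exact: (measurable_rho_of a1 true).
    exact: (measurable_rho_of a1 false).
  by apply: leeD; apply: le_measure; rewrite ?inE.
have fin : balanced Pp Pm (near0_set rhop rhom delta) \is a fin_num.
  have mW := measurable_near0_set a1 delta.
  by rewrite /balanced fin_numM// fin_numD !fin_num_measure.
rewrite -subr_gt0; apply: lt_le_trans (error_gap d0 dt).
rewrite mulr_gt0//; first by rewrite subr_gt0.
by rewrite fine_gt0// pos0 -ge0_fin_numE ?ltW.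
Qed.

End main_bound.

(** * Gaussian features *)

Section gaussian.
Context {R : realType} {n : nat}.
Local Notation Rn := (n.-tuple R).
Local Notation coord := (fun (i : 'I_n) (x : Rn) => tnth x i).

(* normal_prob is a measure on measurableTypeR R, whose display differs from that
   of R, the type of the coordinates of a tuple. *)
Definition normal_law (m s : R) : set R -> \bar R := normal_prob m s.

Let normal_law0 m s : normal_law m s set0 = 0%E.
Proof. exact: (measure0 (normal_prob m s)). Qed.

Let normal_law_ge0 m s A : (0 <= normal_law m s A)%E.
Proof. exact: (measure_ge0 (normal_prob m s)). Qed.

Let normal_law_sigma_additive m s : semi_sigma_additive (normal_law m s).
Proof. exact: (@measure_semi_sigma_additive _ _ _ (normal_prob m s)). Qed.

HB.instance Definition _ m s := isMeasure.Build _ _ _ (normal_law m s)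
  (normal_law0 m s) (normal_law_ge0 m s) (@normal_law_sigma_additive m s).

Let normal_law_setT m s : normal_law m s setT = 1%E.
Proof. exact: (probability_setT (normal_prob m s)). Qed.

HB.instance Definition _ m s := Measure_isProbability.Build _ _ _ (normal_law m s)
  (normal_law_setT m s).

Let measurable_tilt (m s : R) :
  measurable_fun setT (fun y : R => expR (2 * m * y / s ^+ 2)).
Proof.
by apply: measurableT_comp => //; apply: measurable_funM => //; exact: measurable_funM.
Qed.

(** The peaks cancel, and ((y + m)^2 - (y - m)^2)/(2 s^2) = 2 m y/s^2. *)
Lemma normal_law_tilt (m s : R) A : 0 < s -> measurable A ->
  (normal_law m s A =
   \int[normal_law (- m) s]_(y in A) (expR (2 * m * y / s ^+ 2))%:E)%E.
Proof.
move=> s0 mA.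
have mexp := measurable_tilt m s.
rewrite -[A in RHS]setTI integral_mul_indic.
rewrite -(@ge0_integral_law _ _ (measurableTypeR R) R R lebesgue_measure
  (normal_law (- m) s) idfun setT (normal_pdf (- m) s))//.
- rewrite /normal_law /normal_prob -[A in LHS]setTI integral_mul_indic.
  apply: eq_integral => y _; congr EFin; rewrite mulrA; congr (_ * _).
  rewrite !normal_pdfE ?gt_eqF// -[RHS]mulrA /normal_fun -expRD.
  by congr (_ * expR _) => /=; field; rewrite gt_eqF.
- exact: measurable_id.
- exact: measurable_normal_pdf.
- by move=> y; exact: normal_pdf_ge0.
- by move=> B mB; rewrite setTI.
- exact: measurable_funM.
Qed.

(** The normal density is everywhere positive, so mass 0 would make the interval Lebesgue-null,
    against its length 2 eta. *)
Lemma normal_prob_itv_gt0 (m s eta : R) : 0 < s -> 0 < eta ->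
  (0 < normal_prob m s `](- eta)%R, eta%R[%classic)%E.
Proof.
move=> s0 eta0; rewrite lt_neqAle measure_ge0 andbT; apply/negP => /eqP/esym h.
have mA : measurable (`]- eta, eta[%classic : set R) by [].
have := @ge0_integral_eq0_null _ _ _ lebesgue_measure _ _ mA (measurable_normal_pdf m s)
  (fun y _ => normal_pdf_ge0 m s y) h.
rewrite setIidl; last first.
  move=> y _ /=; rewrite normal_pdfE ?gt_eqF// mulr_gt0 ?expR_gt0//.
  by rewrite normal_peak_gt0// gt_eqF.
move=> /(etrans (esym (lebesgue_measure_itv _))).
by rewrite /= lte_fin ifT ?gtrN// -EFinB opprK => -[]; lra.
Qed.

Lemma measurable_tuple_rectangles (A : set Rn) :
  measurable A -> <<s rectangles coord (enum 'I_n) >> A.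
Proof.
apply: smallest_sub; first exact: smallest_sigma_algebra.
rewrite -bigcup_seq => _ [i _ [B mB <-]]; rewrite setTI.
by apply: measurable_rectangles => //; rewrite mem_enum.
Qed.

Lemma isotropic_product_law (m : Rn) (s : R) (P : probability Rn R) :
  isotropic_gaussian m s P ->
  product_law coord P (fun i => normal_law (tnth m i) s : probability R R)
    (enum 'I_n) setT 1.
Proof.
move=> iso A mA; rewrite mul1e setTI big_enum/=.
rewrite (_ : rectangle _ _ _ = [set x | forall i, A i (tnth x i)]); last first.
  apply/seteqP; split => x h i; first by apply: h; rewrite /= mem_enum.
  by move=> _; exact: h.
by rewrite [LHS]iso.
Qed.

Lemma isotropic_gaussian_tilt (m : Rn) (s : R) (Pp Pm : probability Rn R) B :
  0 < s -> isotropic_gaussian m s Pp ->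
  isotropic_gaussian [tuple - tnth m i | i < n] s Pm -> measurable B ->
  (Pp B = \int[Pm]_(x in B)
    (expR (\sum_(i < n) 2 * tnth m i * tnth x i / s ^+ 2))%:E)%E.
Proof.
move=> s0 gp gm mB.
have lp := isotropic_product_law gp; have lm := isotropic_product_law gm.
have := product_law_density (@measurable_tnth _ _ n) (enum_uniq 'I_n)
  measurableT measurableT ler01 lp lm
  (f := fun i y => expR (2 * tnth m i * y / s ^+ 2)) _ _ _
  (measurable_tuple_rectangles mB).
rewrite !setTI => ->.
- by apply: eq_integral => x _; rewrite big_enum/= expR_sum.
- by move=> i; exact: measurable_tilt.
- by move=> i y; exact: expR_ge0.
- by move=> i A mA; rewrite tnth_mktuple; exact: normal_law_tilt.
Qed.

(** The densities are arbitrary versions with respect to an arbitrary [mu], so [psi] has no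
    pointwise formula. Instead, masses are compared: on a small box the two laws are within a factor
    exp(eps/2) of each other, so [psi] can leave the range between exp(-eps) and exp(eps) only on a
    null part of the box. *)
Lemma positive_mass_near0_gaussian (mu : {measure set Rn -> \bar R})
    (rhop rhom : Rn -> R) (Pp Pm : probability Rn R) (m : Rn) (s : R) :
  is_density mu rhop Pp -> is_density mu rhom Pm -> 0 < s ->
  isotropic_gaussian m s Pp ->
  isotropic_gaussian [tuple - tnth m i | i < n] s Pm ->
  positive_mass_near0 rhop rhom Pp Pm.
Proof.
move=> [mp p0 PpE] [mm m0 PmE] s0 gp gm U oU U0.
have [e /= e0 eU] : exists2 e : R, 0 < e & ball 0 e `<=` U.
  by have /nbhs_ballP := open_nbhs_nbhs (conj oU U0).
pose eps := e / 2.
pose c i := 2 * tnth m i / s ^+ 2.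
pose C := \sum_(i < n) `|c i|.
have C0 : 0 <= C by apply: sumr_ge0.
(* On the box the exponent [S] is at most [C * eta] in absolute value, hence at most [eps / 2]; the
   added 1 keeps the divisor positive when [C = 0]. *)
pose eta := eps / 2 / (C + 1).
have eta0 : 0 < eta by rewrite !divr_gt0// ltr_wpDl.
pose S (x : Rn) := \sum_(i < n) 2 * tnth m i * tnth x i / s ^+ 2.
pose box : set Rn := [set x | forall i, tnth x i \in `]- eta, eta[].
have boxS x : box x -> `|S x| <= eps / 2.
  move=> bx; apply: le_trans (ler_norm_sum _ _ _) _.
  apply: (@le_trans _ _ (\sum_(i < n) `|c i| * eta)).
    apply: ler_sum => i _; rewrite mulrAC -/(c i) normrM ler_wpM2l//.
    by have := bx i; rewrite in_itv/= => /andP[? ?]; rewrite ler_norml !ltW.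
  rewrite -mulr_suml -/C /eta mulrCA ler_piMr//.
    by rewrite !divr_ge0// ltW.
  by rewrite ler_pdivrMr ?mul1r ?lerDl// ltr_wpDl.
have mitv : measurable (`]- eta, eta[%classic : set R) by [].
have box_gt0 : (0 < Pm box)%E.
  rewrite (gm (fun=> `]- eta, eta[%classic) (fun=> mitv)).
  elim/big_ind : _ => //.
    by move=> u v; exact: mule_gt0.
  by move=> i _; exact: normal_prob_itv_gt0.
have mbox : measurable box.
  rewrite (_ : box = rectangle coord (enum 'I_n) (fun=> `]- eta, eta[%classic)).
    by apply: measurable_rectangle => // i; exact: measurable_tnth.
  apply/seteqP; split => x h i; first by move=> _; exact: h.
  by apply: h; rewrite /= mem_enum.
have eps0 : 0 < eps by rewrite divr_gt0.
have sandwich B : measurable B -> B `<=` box ->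
    expR (- (eps / 2)) * fine (Pm B) <= fine (Pp B) <= expR (eps / 2) * fine (Pm B).
  move=> mB Bbox; have mS : measurable_fun B (fun x => (expR (S x))%:E).
    apply/measurable_EFinP/measurable_funTS; apply: measurableT_comp => //.
    apply: measurable_sum => i; apply: measurable_funM => //.
    by apply: measurable_funM => //; exact: measurable_tnth.
  have finB (Q : probability Rn R) : Q B = (fine (Q B))%:E.
    by rewrite fineK// fin_num_measure.
  rewrite -2!lee_fin !EFinM -!finB (isotropic_gaussian_tilt s0 gp gm mB).
  rewrite -!integral_cst//; apply/andP; split; apply: ge0_le_integral => //.
  - by move=> x _; rewrite lee_fin expR_ge0.
  - move=> x /Bbox /boxS; rewrite ler_norml => /andP[h _].
    by rewrite lee_fin ler_expR.
  - move=> x /Bbox /boxS; rewrite ler_norml => /andP[_ h].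
    by rewrite lee_fin ler_expR.
(* Integrating either pointwise bound over [B] gives a mass ratio beyond exp(eps) or exp(-eps),
   which contradicts [sandwich] unless [B] has mass 0. *)
have null B : measurable B -> B `<=` box ->
    (forall x, B x -> expR eps * rhom x <= rhop x) \/
    (forall x, B x -> rhop x <= expR (- eps) * rhom x) -> Pm B = 0%E.
  move=> mB Bbox h; have /andP[lo hi] := sandwich B mB Bbox.
  have finB (Q : probability Rn R) : Q B = (fine (Q B))%:E.
    by rewrite fineK// fin_num_measure.
  have scale k : 0 <= k -> ((k * fine (Pm B))%:E =
      \int[mu]_(x in B) (k * rhom x)%:E)%E.
    move=> k0; rewrite EFinM -finB PmE//; under [RHS]eq_integral do rewrite EFinM.
    rewrite ge0_integralZl_EFin//; first by move=> x _; rewrite lee_fin.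
    exact/measurable_EFinP/measurable_funTS.
  have mk k : measurable_fun B (fun x => (k * rhom x)%:E).
    by apply/measurable_EFinP/measurable_funTS; exact: measurable_funM.
  have mpB : measurable_fun B (fun x => (rhop x)%:E).
    exact/measurable_EFinP/measurable_funTS.
  have q0 : 0 <= fine (Pm B) by exact: fine_ge0.
  rewrite finB; congr EFin; apply/eqP; rewrite eq_le q0 andbT leNgt.
  apply/negP => qpos; case: h => h.
    have : (expR eps * fine (Pm B) <= fine (Pp B)).
      rewrite -lee_fin scale ?expR_ge0// -finB PpE//; apply: ge0_le_integral => //.
        by move=> x _; rewrite lee_fin mulr_ge0 ?expR_ge0.
    move=> /le_trans /(_ hi); rewrite ler_pM2r// ler_expR; lra.
  have : (fine (Pp B) <= expR (- eps) * fine (Pm B)).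
    rewrite -lee_fin scale ?expR_ge0// -finB PpE//; apply: ge0_le_integral => //.
      by move=> x _; rewrite lee_fin.
  move=> /(le_trans lo); rewrite ler_pM2r// ler_expR; lra.
have mle (f g : Rn -> R) : measurable_fun setT f -> measurable_fun setT g ->
    measurable [set x | f x <= g x].
  move=> mf mg; rewrite (_ : [set x | _] = ~` [set x | 0 < f x - g x]).
    by apply: measurableC; apply: measurable_fun_gt0; exact: measurable_funB.
  by apply/seteqP; split => x /=; rewrite subr_gt0 leNgt => /negP.
have mk k : measurable_fun setT (fun x => k * rhom x) by exact: measurable_funM.
pose near0 := [set x | U (ln (psi rhop rhom x))].
have mnear0 : measurable near0.
  have mlnpsi : measurable_fun setT (fun x => ln (psi rhop rhom x)).
    by apply: measurableT_comp => //; exact: measurable_psi.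
  by rewrite -[near0]setTI; apply: mlnpsi => //; exact: open_measurable.
pose hi := box `&` [set x | expR eps * rhom x <= rhop x].
pose lo := box `&` [set x | rhop x <= expR (- eps) * rhom x].
pose zero := [set x | rhom x = 0].
have mhi : measurable hi by apply: measurableI => //; exact: mle.
have mlo : measurable lo by apply: measurableI => //; exact: mle.
have mzero : measurable zero by exact: measurable_fun_eq.
have hi0 : Pm hi = 0%E.
  by apply: null => //; [move=> x []|left => x []].
have lo0 : Pm lo = 0%E.
  by apply: null => //; [move=> x []|right => x []].
have zero0 : Pm zero = 0%E.
  by rewrite PmE//; apply: integral0_eq => x zx; congr EFin; exact: zx.
(* Off the three null sets, [rhom] is positive and [psi] lies strictly between exp(-eps) and
   exp(eps), so [ln psi] falls in the ball inside [U]. *)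
have cover : box `<=` ((near0 `|` hi) `|` lo) `|` zero.
  move=> x bx; have [z|z] := eqVneq (rhom x) 0; first by right.
  have rm : 0 < rhom x by rewrite lt_neqAle eq_sym z m0.
  have [h1|h1] := leP (expR eps * rhom x) (rhop x); first by left; left; right.
  have [h2|h2] := leP (rhop x) (expR (- eps) * rhom x); first by left; right.
  left; left; left; apply: eU; rewrite /ball/= sub0r normrN.
  have rp : 0 < rhop x by apply: lt_trans h2; rewrite mulr_gt0 ?expR_gt0.
  have psi0 : 0 < psi rhop rhom x by rewrite divr_gt0.
  apply: (@lt_trans _ _ eps); last by rewrite /eps ltr_pdivrMr// ltr_pMr// ltr1n.
  by rewrite ltr_norml; apply/andP; split; rewrite -ltr_expR lnK ?posrE// /psi
    ?ltr_pdivlMr ?ltr_pdivrMr.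
have : (0 < Pm near0)%E.
  apply: (lt_le_trans box_gt0); apply: (@le_trans _ _ (Pm (((near0 `|` hi) `|` lo) `|` zero))).
    by apply: le_measure; rewrite ?inE//; do 3 apply: measurableU => //.
  by rewrite !measureU0//; do 2 apply: measurableU => //.
move=> pos; rewrite /balanced mule_gt0 ?lte_fin ?invr_gt0//.
by rewrite (lt_le_trans pos)// leeDr.
Qed.

End gaussian.

Unset Implicit Arguments.

Theorem proposition3p6 (R : realType) (n : nat)
    (mu : {measure set (n.-tuple R) -> \bar R}) (rhop rhom : n.-tuple R -> R)
    (Pp Pm : probability (n.-tuple R) R) :
  (forall (a b : R) (d : measure_display) (Omega : measurableType d)
      (P : probability Omega R)
      (K : seq nat -> {RV P >-> nat}) (y : seq nat -> {RV P >-> bool})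
      (X : seq nat -> {RV P >-> n.-tuple R}),
    0 < b -> b < a -> 1 < Delta a b ->
    limit_object a b Pp Pm K y X ->
    assumption1 mu rhop rhom Pp Pm ->
    assumption2 rhop rhom Pp ->
    P [set w | score a b K X rhop rhom 0 w = 0] = 0%E ->
    P [set w | score a b K X rhop rhom 1 w = 0] = 0%E ->
    let E := error a b K y X rhop rhom in
    let t1 := tau1 a b (tau_feat mu rhop rhom) in
    [/\ E 1%N <= E 0%N,
        forall delta : R, 0 < delta -> delta < t1 / 2 ->
          E 0%N - E 1%N >=
            (t1 / 2 - delta) *
            fine (balanced Pp Pm
              [set x | `|ln (psi rhop rhom x)|
                         <= ln ((1 + delta) / (1 - delta))]) &
        positive_mass_near0 rhop rhom Pp Pm -> E 1%N < E 0%N]) /\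
  (forall (m : n.-tuple R) (s : R),
    is_density mu rhop Pp -> is_density mu rhom Pm ->
    m <> [tuple 0 | i < n] -> 0 < s ->
    isotropic_gaussian m s Pp ->
    isotropic_gaussian [tuple - tnth m i | i < n] s Pm ->
    positive_mass_near0 rhop rhom Pp Pm).
Proof.
split.
  move=> a b d Omega P K y X b0 ba _ lim a1 _ tie0 tie1 E t1; split.
  - exact: (error_mono b0 ba lim a1 tie0 tie1).
  - by move=> delta d0 dt; exact: (error_gap b0 ba lim a1 tie0 tie1).
  - exact: (error_lt b0 ba lim a1 tie0 tie1).
move=> m s dp dm _ s0 gp gm.
exact: (positive_mass_near0_gaussian dp dm s0 gp gm).
Qed.
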